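(* Let $w\in\widetilde S_n$ be 321-avoiding and write $F_w=\sum_{u\in\widetilde S_n^0}c^w_uF_u$. Then $c^w_u=0$ unless $u$ is a 321-avoiding $0$-Grassmannian element. Moreover, if $0<m<n$ and $w$ is 321-avoiding with $\mathrm{maxc}(w)\le m$ and $\mathrm{maxr}(w)\le n-m$, then $c^w_u=0$ unless $u\in A^0_{(n-m,m)}$.
   Context: $\widetilde S_n$ is the affine symmetric group with generators $s_i$, $i\in\mathbb Z/n\mathbb Z$ (relations $s_i^2=1$, $s_is_{i+1}s_i=s_{i+1}s_is_{i+1}$, $s_is_j=s_js_i$ for $i-j\ne\pm1$), length $\ell$. $w$ is $0$-Grassmannian if every nonempty reduced word of $w$ ends with $s_0$; $\widetilde S_n^0$ is the set of these. $w$ is 321-avoiding if no reduced word of $w$ contains a consecutive factor $s_is_{i+1}s_i$. For $J\subsetneq\mathbb Z/n\mathbb Z$, $d_J$ (resp. $u_J$) is the product of the $s_j$, $j\in J$, each once, with $s_{j+1}$ left of $s_j$ (resp. $s_j$ left of $s_{j+1}$) whenever $j,j+1\in J$; these are the cyclically decreasing (resp. increasing) elements. $\mathrm{maxr}(w)$ (resp. $\mathrm{maxc}(w)$) is the largest $|J|$ such that $w=vd_J$ (resp. $w=vu_J$) with $\ell(w)=\ell(v)+|J|$. $A^0_{(n-m,m)}$ is the set of 321-avoiding $0$-Grassmannian $u$ with $\mathrm{maxc}(u)\le m$, $\mathrm{maxr}(u)\le n-m$. The affine Stanley symmetric function is $F_w(\mathbf x)=\sum x_1^{\ell(w_1)}x_2^{\ell(w_2)}\cdots$,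 summed over all factorizations $w=w_1w_2\cdots w_l$ into cyclically decreasing elements (identity allowed) with $\sum\ell(w_i)=\ell(w)$. The affine Schur functions $F_u$, $u\in\widetilde S_n^0$, are linearly independent and each $F_w$ is (uniquely) an integer combination $\sum_{u\in\widetilde S_n^0}c^w_uF_u$ of them. *)

(* Defs.v *)
From HB Require Import structures.
From mathcomp Require Import all_boot all_order all_algebra finmap.
From mathcomp Require Import boolp classical_sets functions cardinality fsbigop.

Set Implicit Arguments.
Unset Strict Implicit.
Unset Printing Implicit Defensive.

Import GRing.Theory.
Local Open Scope ring_scope.
Local Open Scope quotient_scope.

(* The Coxeter presentation of the affine symmetric group, as a congruence on
   words in the generators. Since the generators are involutions, the monoid
   with this presentation is the group with this presentation. For n = 2, where
   i + 1 = i - 1, the product s_i s_(i+1) has infinite order: there is no braid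
   relation. *)
Inductive cox_eq (n : nat) : seq 'Z_n -> seq 'Z_n -> Prop :=
| cox_refl a : cox_eq a a
| cox_sym a b : cox_eq a b -> cox_eq b a
| cox_trans a b c : cox_eq a b -> cox_eq b c -> cox_eq a c
| cox_cat a b c d : cox_eq a b -> cox_eq c d -> cox_eq (a ++ c) (b ++ d)
| cox_invol i : cox_eq [:: i; i] [::]
| cox_braid i : (2 < n)%N -> cox_eq [:: i; i + 1; i] [:: i + 1; i; i + 1]
| cox_comm i j : i - j != 1 -> i - j != - 1 -> cox_eq [:: i; j] [:: j; i].

Definition cox_rel (n : nat) : rel (seq 'Z_n) := fun a b => `[< cox_eq a b >].

Lemma cox_rel_equiv (n : nat) : equiv_class_of (@cox_rel n).
Proof.
apply: EquivClass.
- by move=> a; apply/asboolP; exact: cox_refl.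
- by move=> a b; apply/asboolP/asboolP; exact: cox_sym.
- by move=> b a c /asboolP ab /asboolP bc; apply/asboolP; exact: cox_trans bc.
Qed.

Canonical cox_rel_equiv_rel (n : nat) := EquivRelPack (@cox_rel_equiv n).

Definition affSym (n : nat) := {eq_quot (cox_rel_equiv_rel n)}.
HB.instance Definition _ (n : nat) := Choice.on (affSym n).

Section AffSymGroup.
Variable n : nat.
Implicit Types (a b : seq 'Z_n) (x y z : affSym n).

Definition classw a : affSym n := \pi_(affSym n) a.
Definition mulw x y : affSym n := classw (repr x ++ repr y).
Definition invw x : affSym n := classw (rev (repr x)).

Lemma classwP a b : classw a = classw b <-> cox_eq a b.
Proof.
by split=> [/eqmodP/asboolP//|ab]; apply/eqmodP/asboolP.
Qed.

Lemma repr_classw a : cox_eq (repr (classw a)) a.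
Proof. by apply/classwP; rewrite /classw reprK. Qed.

Lemma mulw_class a b : mulw (classw a) (classw b) = classw (a ++ b).
Proof. by apply/classwP/cox_cat; exact: repr_classw. Qed.

Lemma classw_ind (P : affSym n -> Prop) : (forall a, P (classw a)) -> forall x, P x.
Proof. by move=> Pc x; rewrite -[x]reprK; exact: Pc. Qed.

Lemma cox_rev a b : cox_eq a b -> cox_eq (rev a) (rev b).
Proof.
elim=> {a b}.
- by move=> a; exact: cox_refl.
- by move=> a b _; exact: cox_sym.
- by move=> a b c _ ab _; exact: cox_trans.
- by move=> a b c d _ ab _ cd; rewrite !rev_cat; exact: cox_cat.
- by move=> i; exact: cox_invol.
- by move=> i n2; exact: cox_braid.
- by move=> i j ij1 ijN1; apply: cox_sym; exact: cox_comm.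
Qed.

Lemma invw_class a : invw (classw a) = classw (rev a).
Proof. by apply/classwP/cox_rev; exact: repr_classw. Qed.

Lemma cox_revK a : cox_eq (rev a ++ a) [::].
Proof.
elim: a => [|i a IHa]; first exact: cox_refl.
rewrite rev_cons cat_rcons -[i :: i :: a]/([:: i; i] ++ a).
apply: cox_trans IHa; apply: cox_cat; first exact: cox_refl.
by rewrite -[in X in cox_eq _ X](cat0s a); apply: cox_cat;
  [exact: cox_invol | exact: cox_refl].
Qed.

Lemma mulwA : associative mulw.
Proof.
by elim/classw_ind=> a; elim/classw_ind=> b; elim/classw_ind=> c;
  rewrite !mulw_class catA.
Qed.

Lemma mul1w : left_id (classw [::]) mulw.
Proof. by elim/classw_ind=> a; rewrite mulw_class. Qed.

Lemma mulw1 : right_id (classw [::]) mulw.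
Proof. by elim/classw_ind=> a; rewrite mulw_class cats0. Qed.

Lemma mulVw : left_inverse (classw [::]) invw mulw.
Proof.
by elim/classw_ind=> a; rewrite invw_class mulw_class; apply/classwP/cox_revK.
Qed.

Lemma mulwV : right_inverse (classw [::]) invw mulw.
Proof.
elim/classw_ind=> a; rewrite invw_class mulw_class; apply/classwP.
by rewrite -{1}[a]revK; exact: cox_revK.
Qed.

End AffSymGroup.

HB.instance Definition _ (n : nat) :=
  isGroup.Build (affSym n) (@mulwA n) (@mul1w n) (@mulw1 n) (@mulVw n) (@mulwV n).

Definition sgen (n : nat) (i : 'Z_n) : affSym n := classw [:: i].

Definition wprod (n : nat) (a : seq 'Z_n) : affSym n := (\prod_(i <- a) sgen i)%g.

Lemma wprodE (n : nat) (a : seq 'Z_n) : wprod a = classw a.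
Proof.
rewrite /wprod; elim: a => [|i a IHa]; first by rewrite big_nil.
by rewrite big_cons IHa; exact: (mulw_class [:: i] a).
Qed.

Lemma has_word (n : nat) (w : affSym n) :
  exists k, `[< exists2 a : seq 'Z_n, wprod a = w & size a = k >].
Proof.
exists (size (repr w)); apply/asboolP; exists (repr w) => //.
by rewrite wprodE /classw reprK.
Qed.

Definition len (n : nat) (w : affSym n) : nat := ex_minn (has_word w).

Definition reduced_word (n : nat) (w : affSym n) (a : seq 'Z_n) : Prop :=
  wprod a = w /\ size a = len w.

Definition grassmannian0 (n : nat) : set (affSym n) :=
  [set w | forall (a : seq 'Z_n) (i : 'Z_n), reduced_word w (rcons a i) -> i = 0].

Definition avoids321 (n : nat) : set (affSym n) :=
  [set w | forall (a b : seq 'Z_n) (i : 'Z_n),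
     ~ reduced_word w (a ++ [:: i; i + 1; i] ++ b)].

(* All words satisfying one of the next two specifications for a given proper
   subset J differ by commutations of generators, hence have the same product,
   d_J (resp. u_J). *)
Definition decr_word (n : nat) (J : {set 'Z_n}) (a : seq 'Z_n) : Prop :=
  [/\ uniq a, a =i J &
      forall j, j \in J -> j + 1 \in J -> (index (j + 1)%R a < index j a)%N].

Definition incr_word (n : nat) (J : {set 'Z_n}) (a : seq 'Z_n) : Prop :=
  [/\ uniq a, a =i J &
      forall j, j \in J -> j + 1 \in J -> (index j a < index (j + 1)%R a)%N].

Definition is_d (n : nat) (J : {set 'Z_n}) (x : affSym n) : Prop :=
  exists2 a, decr_word J a & x = wprod a.

Definition is_u (n : nat) (J : {set 'Z_n}) (x : affSym n) : Prop :=
  exists2 a, incr_word J a & x = wprod a.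

Definition cyc_decreasing (n : nat) (x : affSym n) : Prop :=
  exists2 J : {set 'Z_n}, J \proper [set: 'Z_n]%SET & is_d J x.

Definition maxr (n : nat) (w : affSym n) : nat :=
  \max_(J : {set 'Z_n} | (J \proper [set: 'Z_n]%SET) &&
     `[< exists v x, [/\ is_d J x, w = (v * x)%g & len w = (len v + #|J|)%N] >])
    #|J|.

Definition maxc (n : nat) (w : affSym n) : nat :=
  \max_(J : {set 'Z_n} | (J \proper [set: 'Z_n]%SET) &&
     `[< exists v x, [/\ is_u J x, w = (v * x)%g & len w = (len v + #|J|)%N] >])
    #|J|.

(* The set A^0_(n-m,m). *)
Definition A0 (n m : nat) : set (affSym n) :=
  [set u | [/\ avoids321 u, grassmannian0 u,
               (maxc u <= m)%N & (maxr u <= n - m)%N]].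

(* Factorizations w = w_1 ... w_l contributing x_1^(alpha_1) ... x_l^(alpha_l). *)
Definition cyc_factorizations (n : nat) (w : affSym n) (alpha : seq nat) :
    set (seq (affSym n)) :=
  [set t | [/\ forall x, x \in t -> cyc_decreasing x,
               map (@len n) t = alpha,
               w = (\prod_(x <- t) x)%g &
               (\sum_(x <- t) len x)%N = len w]].

Lemma finite_cyc_decreasing (n : nat) : finite_set (@cyc_decreasing n).
Proof.
pose f (p : {k : 'I_#|{: 'Z_n}|.+1 & k.-tuple 'Z_n}) := wprod (tagged p).
apply: (@sub_finite_set _ _ (f @` setT)%classic); last first.
  by apply: finite_image; exact: finite_finset.
move=> x [J _ [a [ua _ _] ->]].
have sa : (size a < #|{: 'Z_n}|.+1)%N by rewrite ltnS -(card_uniqP ua) max_card.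
by exists (Tagged (fun k : 'I__ => k.-tuple 'Z_n) (in_tuple a : (Ordinal sa).-tuple _)).
Qed.

Lemma finite_cyc_factorizations (n : nat) (w : affSym n) (alpha : seq nat) :
  finite_set (cyc_factorizations w alpha).
Proof.
suff fin_seq k : finite_set [set t : seq (affSym n) |
    (forall x, x \in t -> cyc_decreasing x) /\ size t = k].
  apply: sub_finite_set (fin_seq (size alpha)) => t [cyc <- _ _].
  by rewrite /= size_map.
elim: k => [|k IHk].
  apply: (@sub_finite_set _ _ [set [::]]%classic); last exact: finite_set1.
  by case=> // x t [].
apply: (@sub_finite_set _ _ [set y :: s | y in @cyc_decreasing n & s in
  [set t : seq (affSym n) | (forall x, x \in t -> cyc_decreasing x) /\
     size t = k]]%classic); last first.
  by apply: finite_image2 => //; exact: finite_cyc_decreasing.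
case=> [|y t] [cyc] //= [st]; exists y; first by apply: cyc; rewrite mem_head.
exists t => //; split=> // x xt; apply: cyc; by rewrite inE xt orbT.
Qed.

(* The affine Stanley symmetric function, as a formal power series in
   x_1, x_2, ...: affStanley w [:: alpha_1; ...; alpha_l] is the coefficient of
   x_1^(alpha_1) ... x_l^(alpha_l). As the identity is an allowed factor, it is
   insensitive to trailing zeros in the exponent sequence. *)
Definition affStanley (n : nat) (w : affSym n) (alpha : seq nat) : int :=
  (#|` fset_set (cyc_factorizations w alpha)|)%:Z.

(* Main.v *)
Require Import Defs.
From mathcomp Require Import all_boot all_order all_algebra finmap.
From mathcomp Require Import boolp classical_sets functions cardinality fsbigop.
From mathcomp Require Import zify.


(** Put particles on the sites of Z/n and let [s_i] exchange the sites [i] and [i + 1].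
    A word is called raising on a state when each of its letters [i], read from the
    right, moves a particle from [i] to [i + 1]; such a word is reduced, and two raising
    words with the same source and target are equivalent. A 321-avoiding [w] raises some
    state [S], with [m] particles for any [m] such that [maxc w <= m] and
    [maxr w <= n - m]; conversely an element that raises a state with [m] particles
    satisfies these bounds and (for [n > 2]) is 321-avoiding.

    Hence the coefficients of [F_w] are matrix coefficients of products of the Pieri
    operators (sum over all the cyclically decreasing moves of a given size) acting on
    states. These operators commute, and the vacuum, whose occupied sites are
    [1 - m, ..., 0], is a cyclic vector for the algebra they generate. Moving to the
    vacuum an operator that creates [S] expresses [F_w] as a combination of the [F_u] for
    [u] raising the vacuum, and every such [u] is 0-Grassmannian. Linear independence of
    the affine Schur functions then identifies this expansion with the given one. *)

Set Implicit Arguments.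
Unset Strict Implicit.
Unset Printing Implicit Defensive.

Import Order.TTheory GRing.Theory Num.Theory.
Local Open Scope ring_scope.

(** * Particle states *)

Section Particles.
Variable n : nat.
Implicit Types (i j x y : 'Z_n) (a b : seq 'Z_n) (S T J : {set 'Z_n}) (u v w : affSym n).

(** Source and target determine a raising element only together with its length, because a
    configuration can return to itself after turning round the cycle; homogeneity of $F_w$ supplies
    the length. Conservation of the particle number carries the two bounds from $w$ to every $u$ of
    the expansion. Commutation is proved as for the transfer matrices of integrable lattice models:
    two successive moves are read site by site, their generating function becomes the trace of a
    product of 4 by 4 matrices round the cycle, and an R-matrix exchanges the two variables in every
    factor. Cyclicity is a triangularity: a state is one term of a Pieri sum taken at a state of
    smaller energy, and the other terms come earlier in a well-founded order. The resulting
    operators involve subtractions, so the argument controls the support of the coefficients but not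
    their signs. *)

Lemma Zp_add1_neq x : x + 1 != x.
Proof. by rewrite -subr_eq0 addrC addKr oner_eq0. Qed.

Lemma Zp_sub1_neq x : x - 1 != x.
Proof. by rewrite -subr_eq0 addrC addKr oppr_eq0 oner_eq0. Qed.

Lemma Zp_add1_eq_sub1 x : (x + 1 == x - 1) -> (n <= 2)%N.
Proof.
rewrite (inj_eq (addrI x)) => /eqP/(congr1 val); case: n x => [|[|[|k]]] x //=.
by rewrite !modn_small //; lia.
Qed.

Lemma Zp_eq_add_nat x y : x = y + (nat_of_ord (x - y)%R)%:R.
Proof. by rewrite natr_Zp addrC subrK. Qed.

Lemma Zp_succ_closed (P : pred 'Z_n) x : P x -> (forall y, P y -> P (y + 1)) ->
  forall y, P y.
Proof.
move=> Px PS y; rewrite (Zp_eq_add_nat y x).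
elim: (nat_of_ord (y - x)%R) => [|k IH]; first by rewrite addr0.
by rewrite -natr1 addrA; exact: PS.
Qed.

Lemma Zp_pred_closed (P : pred 'Z_n) x : P x -> (forall y, P y -> P (y - 1)) ->
  forall y, P y.
Proof.
move=> Px PP y; have -> : y = - (- y) by rewrite opprK.
apply: (@Zp_succ_closed (fun z => P (- z)) (- x)); first by rewrite opprK.
by move=> z; rewrite opprD; exact: PP.
Qed.

Definition swap_site i x : 'Z_n := if x == i then i + 1 else if x == i + 1 then i else x.

Definition act i S : {set 'Z_n} := [set x | swap_site i x \in S].

Lemma in_act i S x : (x \in act i S) =
  if x == i then i + 1 \in S else if x == i + 1 then i \in S else x \in S.
Proof. by rewrite inE /swap_site; do 2?case: ifP. Qed.

Definition gain i S : int := (i \in S)%:Z - (i + 1 \in S)%:Z.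

Definition actw a S := foldr act S a.

(** The signed number of jumps. It respects all Coxeter relations and never exceeds the length of
    the word. Equality characterizes the raising words, which is why these are reduced. *)
Fixpoint energy a S : int :=
  if a is i :: a' then gain i (actw a' S) + energy a' S else 0.

Lemma actw_cat a b S : actw (a ++ b) S = actw a (actw b S).
Proof. exact: foldr_cat. Qed.

Lemma energy_cat a b S : energy (a ++ b) S = energy a (actw b S) + energy b S.
Proof. by elim: a => [|i a IH] /=; rewrite ?add0r // IH actw_cat addrA. Qed.

Lemma cox_eq_act a b : cox_eq a b ->
  forall S, actw a S = actw b S /\ energy a S = energy b S.
Proof.
elim=> {a b} //.
- by move=> a b _ IH S; have [-> ->] := IH S.
- by move=> a b c _ IH1 _ IH2 S; have [-> ->] := IH1 S.
- move=> a b c d _ IH1 _ IH2 S; rewrite !actw_cat !energy_cat.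
  by have [-> ->] := IH2 S; have [-> ->] := IH1 (actw d S).
- move=> i S; have ii1 := negbTE (Zp_add1_neq i); split.
    apply/setP=> x; rewrite /= !in_act !eqxx ii1.
    by case: (eqVneq x i) => [->|xi]; rewrite ?ii1 //; case: (eqVneq x (i + 1)) => [->|].
  rewrite /= /gain !in_act !eqxx ii1 addr0; do 2!case: (_ \in S); clear; lia.
- move=> i n2 S.
  have ii1 := negbTE (Zp_add1_neq i); have i1i := negbTE (Zp_add1_neq (i + 1)).
  have i2i : (i + 1 + 1 == i) = false.
    apply/negP=> /eqP e; suff /Zp_add1_eq_sub1 : i + 1 == i - 1 by lia.
    by rewrite -{2}e addrK.
  have e1 : (i == i + 1) = false by rewrite eq_sym.
  have e2 : (i + 1 == i + 1 + 1) = false by rewrite eq_sym.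
  have e3 : (i == i + 1 + 1) = false by rewrite eq_sym.
  split.
    apply/setP=> x; rewrite /= !in_act !eqxx ?ii1 ?i1i ?i2i ?e1 ?e2 ?e3.
    case: (eqVneq x i) => [->|xi]; first by rewrite ?e1 ?e3 ?ii1 ?i1i ?i2i.
    by case: (eqVneq x (i + 1)) => // xi1; case: (eqVneq x (i + 1 + 1)).
  rewrite /= /gain !in_act !eqxx ?ii1 ?i1i ?i2i ?e1 ?e2 ?e3; do 3!case: (_ \in S); clear; lia.
- move=> i j ij1 ijN1 S.
  case: (i =P j) => [->//|/eqP ij].
  have ij' := negbTE ij; have ji' : (j == i) = false by rewrite eq_sym.
  have e1 : (i == j + 1) = false.
    by apply/negbTE; apply: contraNN ij1 => /eqP ->; rewrite addrC addKr.
  have e2 : (j == i + 1) = false.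
    by apply/negbTE; apply: contraNN ijN1 => /eqP ->; rewrite opprD addrA subrr add0r.
  have e1' : (j + 1 == i) = false by rewrite eq_sym.
  have e2' : (i + 1 == j) = false by rewrite eq_sym.
  have e3 : (i + 1 == j + 1) = false by rewrite (inj_eq (addIr 1)).
  have e3' : (j + 1 == i + 1) = false by rewrite (inj_eq (addIr 1)).
  split.
    apply/setP=> x; rewrite /= !in_act ?e1 ?e2 ?e1' ?e2' ?e3 ?e3' ?ij' ?ji'.
    case: (eqVneq x i) => [->|xi]; first by rewrite ij' e1.
    case: (eqVneq x (i + 1)) => [->|xi1]; first by rewrite ?e2' ?e3.
    by case: (eqVneq x j) => // xj; case: (eqVneq x (j + 1)).
  rewrite /= /gain !in_act ?e1 ?e2 ?e1' ?e2' ?e3 ?e3' ?ij' ?ji' ?eqxx.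
  by rewrite !addr0 addrC.
Qed.
End Particles.

(** * Raising words *)

Section Words.
Variable n : nat.
Implicit Types (i j x y : 'Z_n) (a b : seq 'Z_n) (S T J : {set 'Z_n}) (u v w : affSym n).

Lemma wprod_cat a b : wprod (a ++ b) = (wprod a * wprod b)%g.
Proof. by rewrite /wprod big_cat. Qed.

Lemma wprodP a b : wprod a = wprod b <-> cox_eq a b.
Proof. by rewrite !wprodE; exact: classwP. Qed.

Lemma len_le_size a : (len (wprod a) <= size a)%N.
Proof. by rewrite /len; case: ex_minnP => k _; apply; apply/asboolP; exists a. Qed.

Lemma reduced_word_exists w : exists a, reduced_word w a.
Proof.
rewrite /reduced_word /len; case: ex_minnP => k /asboolP[a aw sa] _.
by exists a.
Qed.

Lemma reduced_catl w a b : reduced_word w (a ++ b) -> reduced_word (wprod a) a.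
Proof.
move=> [<- sz]; split=> //; apply/eqP; rewrite eq_sym eqn_leq len_le_size /=.
have [c [ca sc]] := reduced_word_exists (wprod a).
have := len_le_size (c ++ b); rewrite wprod_cat ca -wprod_cat -sz !size_cat sc.
by rewrite leq_add2r.
Qed.

Lemma reduced_cox w a b : cox_eq a b -> size a = size b ->
  reduced_word w a -> reduced_word w b.
Proof. by move=> /wprodP ab sab [<- sz]; split; rewrite -?ab // -sab. Qed.

Lemma reduced_mul v w a b : reduced_word v a -> reduced_word w b ->
  len (v * w)%g = (len v + len w)%N -> reduced_word (v * w)%g (a ++ b).
Proof. by move=> [<- sa] [<- sb] l; split; rewrite ?wprod_cat // size_cat sa sb l. Qed.

Lemma cox_catl a b c : cox_eq b c -> cox_eq (a ++ b) (a ++ c).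
Proof. by move=> bc; apply: cox_cat => //; exact: cox_refl. Qed.

Lemma cox_catr a b c : cox_eq a b -> cox_eq (a ++ c) (b ++ c).
Proof. by move=> ab; apply: cox_cat => //; exact: cox_refl. Qed.

Lemma cox_comm_seq i a : i + 1 \notin a -> i - 1 \notin a ->
  cox_eq (i :: a) (rcons a i).
Proof.
elim: a => [|j a IH]; first by move=> _ _; exact: cox_refl.
rewrite !inE !negb_or => /andP[ij1 ia1] /andP[ijN1 iaN1].
apply: (@cox_trans _ _ (j :: i :: a)); last exact: (@cox_catl [:: j] _ _ (IH ia1 iaN1)).
apply: (@cox_catr [:: i; j] [:: j; i] a); apply: cox_comm.
  by apply: contraNN ijN1; rewrite subr_eq => /eqP ->; rewrite addrC addKr.
by apply: contraNN ij1; rewrite subr_eq => /eqP ->; rewrite addrAC addNr add0r.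
Qed.

Lemma len1 : len (1%g : affSym n) = 0%N.
Proof. by have := len_le_size [::]; rewrite /wprod big_nil leqn0 => /eqP. Qed.

Lemma len_eq0 w : len w = 0%N -> w = 1%g.
Proof.
have [[|i a] [<- sz]] := reduced_word_exists w; first by rewrite /wprod big_nil.
by rewrite -sz.
Qed.

Fixpoint up a S : bool :=
  if a is i :: a' then [&& up a' S, i \in actw a' S & i + 1 \notin actw a' S]
  else true.

Lemma up_cat a b S : up (a ++ b) S = up b S && up a (actw b S).
Proof.
by elim: a => [|i a IH] /=; [rewrite andbT | rewrite IH actw_cat -andbA].
Qed.

Lemma gain_le1 i S : gain i S <= 1.
Proof. by rewrite /gain; do 2!case: (_ \in S); clear; lia. Qed.

Lemma gain_eq1 i S : (gain i S == 1) = (i \in S) && (i + 1 \notin S).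
Proof. by rewrite /gain; do 2!case: (_ \in S); clear; lia. Qed.

Lemma energy_le_size a S : energy a S <= (size a)%:Z.
Proof.
by elim: a => [|i a IH] //=; rewrite -add1n PoszD lerD // gain_le1.
Qed.

Lemma upE a S : up a S = (energy a S == (size a)%:Z).
Proof.
elim: a => [|i a IH] //=; rewrite IH -gain_eq1.
have := energy_le_size a S; have := gain_le1 i (actw a S).
move: (gain _ _) (energy _ _) (size a) => g e s; clear; lia.
Qed.

Lemma up_cox a b S : cox_eq a b -> size a = size b -> up a S = up b S.
Proof. by move=> /cox_eq_act/(_ S)[_ e] s; rewrite !upE e s. Qed.

Lemma up_reduced a S : up a S -> reduced_word (wprod a) a.
Proof.
rewrite upE => /eqP e; split=> //; apply/eqP; rewrite eqn_leq len_le_size andbT.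
have [b [/wprodP/cox_eq_act/(_ S)[_ eb] <-]] := reduced_word_exists (wprod a).
by have := energy_le_size b S; rewrite eb e.
Qed.

Lemma card_act i S : #|act i S| = #|S|.
Proof.
have inv x : swap_site i (swap_site i x) = x.
  rewrite /swap_site; case: (eqVneq x i) => [->|xi].
    by rewrite (negbTE (Zp_add1_neq i)) eqxx.
  by case: (eqVneq x (i + 1)) => [->|xi1]; rewrite ?eqxx // (negbTE xi) (negbTE xi1).
have -> : act i S = swap_site i @: S.
  apply/setP=> x; rewrite inE; apply/idP/imsetP => [xS|[y yS ->]]; last by rewrite inv.
  by exists (swap_site i x).
by rewrite card_imset //; exact: can_inj inv.
Qed.

Lemma card_actw a S : #|actw a S| = #|S|.
Proof. by elim: a => //= i a; rewrite card_act. Qed.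

(** Conservation at the site [x]: the letter [x] takes a particle out, the letter [x - 1] brings one
    in. *)
Lemma up_count a S x : up a S ->
  ((x \in actw a S) + count_mem x a = (x \in S) + count_mem (x - 1)%R a)%N.
Proof.
elim: a => [|i a IH] //= /and3P[/IH{}IH i1 i2]; rewrite in_act.
have -> : (i == x - 1) = (x == i + 1) by rewrite eq_sym subr_eq.
move: IH; rewrite (eq_sym i x); case: (eqVneq x i) => [->|xi].
  rewrite (eq_sym i (i + 1)) (negbTE (Zp_add1_neq i)) i1 (negbTE i2) add0n add1n.
  by move=> e; rewrite add0n e.
case: (eqVneq x (i + 1)) => [->|xi1]; last by [].
by rewrite i1 (negbTE i2) !add0n => ->; rewrite add1n addnS.
Qed.

(** By conservation the difference of the two counts is the same at every site of the cycle, and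
    equal sizes make these differences sum to zero. Without equal sizes the words could differ by
    full turns. *)
Lemma up_count_eq a b S : up a S -> up b S -> actw a S = actw b S ->
  size a = size b -> forall x, count_mem x a = count_mem x b.
Proof.
move=> ua ub eab sab.
have step x : (count_mem x a + count_mem (x - 1)%R b =
               count_mem x b + count_mem (x - 1)%R a)%N.
  have := up_count x ua; have := up_count x ub; rewrite eab.
  move: (count_mem x a) (count_mem x b) (count_mem _ a) (count_mem _ b) => p q r s.
  move: (nat_of_bool _) (nat_of_bool _) => e f; clear; lia.
pose d x := (count_mem x a)%:Z - (count_mem x b)%:Z.
have dc x : d x = d 0.
  apply/eqP; apply: (@Zp_succ_closed n (fun z => d z == d 0) 0) => // y /eqP <-.
  have := step (y + 1); rewrite addrK /d.
  move: (count_mem y a) (count_mem y b) (count_mem _ a) (count_mem _ b) => p q r s.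
  clear; lia.
have sumc c : (\sum_x count_mem x c)%N = size c.
  elim: c => [|i c IH] /=; first by rewrite big1.
  rewrite big_split /= IH (bigD1 i) //= eqxx big1 ?addn0 // => x xi.
  by rewrite eq_sym (negbTE xi).
have sd : \sum_x d x = 0.
  by rewrite /d big_split /= sumrN -!(big_morph Posz PoszD (erefl _)) !sumc sab subrr.
move: sd; rewrite (eq_bigr (fun=> d 0)) => [|x _]; last exact: dc.
rewrite sumr_const => /eqP; rewrite mulrn_eq0 card_ord /= => /eqP d0 x.
by apply/eqP; rewrite -eqz_nat -subr_eq0 -/(d x) dc d0.
Qed.

(* A particle that is free to jump blocks both neighbouring jumps until it moves,
   so the rightmost occurrence of its letter commutes to the right end. *)
Lemma up_frozen i b S : i \in S -> i + 1 \notin S -> up b S -> i \notin b ->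
  [/\ i \in actw b S, i + 1 \notin actw b S, i + 1 \notin b & i - 1 \notin b].
Proof.
move=> iS i1S; elim: b => [|j b IH] //= /and3P[ub jb j1b].
rewrite inE negb_or => /andP[ij ib]; have [ib1 ib2 ib3 ib4] := IH ub ib.
have ij1 : i + 1 != j by apply: contraNneq ib2 => ->.
have ijN : i - 1 != j by rewrite subr_eq; apply: contraNneq j1b => <-.
have i1j1 : i + 1 != j + 1 by rewrite (inj_eq (addIr 1)).
have ij2 : i != j + 1 by rewrite -subr_eq.
by rewrite !in_act !inE (negbTE ij) (negbTE ij1) (negbTE i1j1) (negbTE ij2) (negbTE ijN).
Qed.

Lemma last_occurrence (U : eqType) (z : U) (s : seq U) : z \in s ->
  exists s1 s2, s = s1 ++ z :: s2 /\ z \notin s2.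
Proof.
elim: s => // y s IH; case: (boolP (z \in s)) => [zs _|zs].
  by have [s1 [s2 [-> zs2]]] := IH zs; exists (y :: s1), s2.
by rewrite inE (negbTE zs) orbF => /eqP <-; exists [::], s.
Qed.

(** Induction on the size. The last letter of [a] occurs in [b] by the count of letters; its
    rightmost occurrence there commutes to the right end, where both words lose it. *)
Lemma up_unique a b S : up a S -> up b S -> actw a S = actw b S ->
  size a = size b -> cox_eq a b.
Proof.
move: {-1}(size a) (erefl (size a)) => k.
elim: k a b S => [|k IH] a b S sa ua ub eab sab.
  by move: sab; rewrite (size0nil sa) /= => /esym/size0nil ->; exact: cox_refl.
case/lastP: a sa ua eab sab => [//|a i]; rewrite size_rcons => -[sa] ua eab sab.
have ib : i \in b.
  have := up_count_eq ua ub eab; rewrite size_rcons sa => /(_ sab i).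
  rewrite -cats1 count_cat /= eqxx addnC => e.
  by rewrite -has_pred1 has_count -e.
have [b1 [b2 [eb ib2]]] : exists b1 b2, b = b1 ++ i :: b2 /\ i \notin b2.
  exact: last_occurrence.
move: ub eab sab; rewrite eb {b ib eb} => ub eab sab.
move: (ua) (ub); rewrite -cats1 !up_cat /= => /andP[/andP[iS i1S] ua'].
case/andP=> /and3P[ub2 _ _] _.
have [_ _ i1b2 iNb2] := up_frozen iS i1S ub2 ib2.
have cb : cox_eq (b1 ++ i :: b2) ((b1 ++ b2) ++ [:: i]).
  by rewrite -catA cats1; apply: cox_catl; exact: cox_comm_seq.
have scb : size (b1 ++ i :: b2) = size ((b1 ++ b2) ++ [:: i]) by rewrite !size_cat /= addn1 addnS.
apply: cox_trans (cox_sym cb); apply: cox_catr.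
move: ub; rewrite (up_cox _ cb scb) up_cat => /andP[_ ub'].
move: eab; rewrite (cox_eq_act cb _).1 -cats1 (actw_cat a) (actw_cat (b1 ++ b2)) => eab.
apply: (IH _ _ _ sa ua' ub' eab).
by move: sab; rewrite scb size_cat addn1 => -[].
Qed.

Definition rword w : seq 'Z_n := projT1 (cid (reduced_word_exists w)).

Lemma rwordP w : reduced_word w (rword w).
Proof. exact: (projT2 (cid _)). Qed.

Definition raises w S : bool := up (rword w) S.

Definition actg w S : {set 'Z_n} := actw (rword w) S.

Lemma actgE w a S : wprod a = w -> actg w S = actw a S.
Proof.
by move=> e; apply: (cox_eq_act _ S).1; apply/wprodP; rewrite e (rwordP w).1.
Qed.

Lemma raisesE w a S : reduced_word w a -> raises w S = up a S.
Proof.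
move=> [e s]; apply: up_cox; last by rewrite s (rwordP w).2.
by apply/wprodP; rewrite e (rwordP w).1.
Qed.

Lemma raises_up a S : up a S -> raises (wprod a) S.
Proof. by move=> ua; rewrite (raisesE _ (up_reduced ua)). Qed.

Lemma actgM v w S : actg (v * w)%g S = actg v (actg w S).
Proof.
rewrite /actg -actw_cat -/(actg _ _); apply: actgE.
by rewrite wprod_cat (rwordP v).1 (rwordP w).1.
Qed.

Lemma raisesM v w S : len (v * w)%g = (len v + len w)%N ->
  raises (v * w)%g S = raises w S && raises v (actg w S).
Proof. by move/(reduced_mul (rwordP v) (rwordP w))/raisesE ->; rewrite up_cat. Qed.

(** The concatenated words are again raising, hence reduced: additivity of lengths comes for
    free. *)
Lemma raises_mul v w S : raises w S -> raises v (actg w S) ->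
  raises (v * w)%g S /\ len (v * w)%g = (len v + len w)%N.
Proof.
move=> rw rv; have : up (rword v ++ rword w) S by rewrite up_cat; apply/andP.
move=> u; have [_] := up_reduced u; have := raises_up u.
by rewrite wprod_cat size_cat !(rwordP _).1 !(rwordP _).2.
Qed.

Lemma raises_unique v w S : raises v S -> raises w S -> actg v S = actg w S ->
  len v = len w -> v = w.
Proof.
move=> rv rw e l; rewrite -(rwordP v).1 -(rwordP w).1; apply/wprodP.
by apply: (up_unique rv rw e); rewrite !(rwordP _).2.
Qed.

Lemma card_actg w S : #|actg w S| = #|S|.
Proof. exact: card_actw. Qed.

Lemma raises1 S : raises 1%g S.
Proof. by have := @raises_up [::] S isT; rewrite /wprod big_nil. Qed.

Lemma actg1 S : actg 1%g S = S.
Proof. by rewrite (@actgE _ [::]) // /wprod big_nil. Qed.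

End Words.

(** * Cyclically decreasing elements *)

Section CyclicallyDecreasing.
Variable n : nat.
Implicit Types (i j x y : 'Z_n) (a b : seq 'Z_n) (S T J : {set 'Z_n}) (u v w : affSym n).

Lemma index_rcons_neq a x y : x \in a -> index x (rcons a y) = index x a.
Proof. by move=> xa; rewrite -cats1 index_cat xa. Qed.

Lemma index_rcons_last a x : x \notin a -> index x (rcons a x) = size a.
Proof. by move=> xa; rewrite -cats1 index_cat (negbTE xa) /= eqxx addn0. Qed.

Lemma decr_rcons J a j : decr_word J (rcons a j) ->
  [/\ j \in J, j - 1 \notin J & decr_word (J :\ j) a].
Proof.
case; rewrite rcons_uniq => /andP[ja ua] aJ idx.
have jJ : j \in J by rewrite -aJ mem_rcons mem_head.
have jNJ : j - 1 \notin J.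
  apply/negP=> jNJ; have := idx _ jNJ; rewrite subrK => /(_ jJ).
  rewrite (index_rcons_last ja) ltnNge -ltnS -(size_rcons a j) index_mem aJ.
  by rewrite jNJ.
have memJ x : (x \in J :\ j) = (x \in a).
  rewrite in_setD1 -aJ mem_rcons inE; case: eqVneq => [->|//].
  by rewrite (negbTE ja).
split=> //; split=> // x; rewrite !memJ => xa x1a.
by have := idx x; rewrite -!aJ !mem_rcons !inE xa x1a !orbT !index_rcons_neq //; apply.
Qed.

Lemma decr_rcons_intro J a j : decr_word J a -> j \notin J -> j - 1 \notin J ->
  decr_word (j |: J) (rcons a j).
Proof.
case=> ua aJ idx jJ jNJ; have ja : j \notin a by rewrite aJ.
split; first by rewrite rcons_uniq ja.
  by move=> x; rewrite mem_rcons !inE aJ.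
move=> x; rewrite !inE; case: (eqVneq x j) => [->|xj] /=.
  rewrite (negbTE (Zp_add1_neq j)) /= => _ j1J.
  by rewrite index_rcons_last // index_rcons_neq ?aJ // index_mem aJ.
move=> xJ; case: eqVneq => [xj1|_] /=; first by rewrite -xj1 addrK xJ in jNJ.
by move=> x1J; rewrite !index_rcons_neq ?aJ //; exact: idx.
Qed.

Lemma proper_set_start J : J \proper [set: 'Z_n] -> J != finset.set0 ->
  exists2 j, j \in J & j - 1 \notin J.
Proof.
move=> pJ /finset.set0Pn[x xJ].
case: (pselect (exists2 j, j \in J & j - 1 \notin J)) => // nex.
suff JT y : y \in J by case/properP: pJ => _ [y _]; rewrite JT.
apply: (@Zp_pred_closed n (mem J) x) => // z zJ; apply: contrapT => /negP zNJ.
by apply: nex; exists z.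
Qed.

Lemma decr_word_exists J : J \proper [set: 'Z_n] -> exists a, decr_word J a.
Proof.
move: {2}#|J| (erefl #|J|) => k; elim: k J => [|k IH] J cJ pJ.
  by exists [::]; split=> // x; rewrite (cards0_eq cJ) !inE.
have J0 : J != finset.set0 by rewrite -card_gt0 cJ.
have [j jJ jNJ] := proper_set_start pJ J0.
have [||a aJ] := IH (J :\ j).
- by move: cJ; rewrite (cardsD1 j J) jJ => -[].
- exact: sub_proper_trans (finset.subD1set _ _) pJ.
exists (rcons a j); rewrite -(finset.setD1K jJ).
by apply: decr_rcons_intro; rewrite // !inE ?eqxx // (negbTE jNJ) andbF.
Qed.

Lemma size_decr J a : decr_word J a -> size a = #|J|.
Proof. by case=> /card_uniqP <- aJ _; apply: eq_card. Qed.

(** The condition for [d_J] to raise [S]. The rightmost letter of each cyclic interval of [J] is its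
    first site, so a single particle runs across the whole interval: it must start at the first site
    and find all later sites, and the one just beyond, empty. *)
Definition valid J S : bool :=
  [forall j in J, (j + 1 \notin S) && ((j \in S) || (j - 1 \in J))].

Definition mv J S : {set 'Z_n} := [set x | (x \notin J) && ((x \in S) || (x - 1 \in J))].

Lemma validP J S :
  reflect (forall j, j \in J -> j + 1 \notin S /\ ((j \in S) || (j - 1 \in J))) (valid J S).
Proof.
apply: (iffP forall_inP) => H j /H; first by move=> /andP.
by move=> [-> ->].
Qed.

Lemma valid_start J S j : j \in J -> j - 1 \notin J ->
  valid J S = [&& j \in S, j + 1 \notin S & valid (J :\ j) (act j S)].
Proof.
move=> jJ jNJ; apply/validP/and3P => [vJ|[jS j1S /validP vJ]].
  have [j1S] := vJ j jJ; rewrite (negbTE jNJ) orbF => jS; split=> //.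
  apply/validP=> y; rewrite in_setD1 => /andP[yj yJ]; have [y1S yS] := vJ y yJ.
  have y1j : y + 1 != j by apply: contraNneq jNJ => <-; rewrite addrK.
  rewrite !in_act !in_setD1 (negbTE y1j) (inj_eq (addIr 1)) (negbTE yj) y1S subr_eq.
  by split=> //; case: eqVneq => _; rewrite ?jS.
move=> y yJ; case: (eqVneq y j) => [->|yj]; first by rewrite jS.
have := vJ y; rewrite in_setD1 yj yJ => /(_ isT).
have y1j : y + 1 != j by apply: contraNneq jNJ => <-; rewrite addrK.
rewrite !in_act !in_setD1 (negbTE y1j) (inj_eq (addIr 1)) (negbTE yj) subr_eq.
by case: eqVneq => [->|_] //; rewrite addrK jJ orbT => -[].
Qed.

Lemma mv_start J S j : j \in J -> j - 1 \notin J -> valid J S ->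
  mv (J :\ j) (act j S) = mv J S.
Proof.
move=> jJ jNJ vJ; have := vJ; rewrite (valid_start _ jJ jNJ) => /and3P[jS j1S _].
apply/setP=> x; rewrite !inE /swap_site subr_eq.
case: (eqVneq x j) => [->|xj] /=; first by rewrite (negbTE j1S) (negbTE jNJ) andbF jJ.
by case: eqVneq => [->|_] /=; rewrite ?jS ?addrK ?jJ ?orbT.
Qed.

Lemma decr_up J a S : decr_word J a -> up a S = valid J S.
Proof.
elim/last_ind: a J S => [|a j IH] J S.
  by case=> _ J0 _; apply/esym/validP=> j; rewrite -J0.
move=> /decr_rcons[jJ jNJ dJ]; rewrite (valid_start _ jJ jNJ) -(IH _ _ dJ).
by rewrite -cats1 up_cat /= -andbA.
Qed.

Lemma decr_act J a S : decr_word J a -> valid J S -> actw a S = mv J S.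
Proof.
elim/last_ind: a J S => [|a j IH] J S.
  by case=> _ J0 _ _; apply/setP=> x; rewrite inE -!J0 /= orbF.
move=> /decr_rcons[jJ jNJ dJ] vJ; rewrite -(mv_start jJ jNJ vJ) -cats1 actw_cat /=.
by apply: IH => //; move: vJ; rewrite (valid_start _ jJ jNJ) => /and3P[].
Qed.

(* Any state raised by d_J would do; this one places a single particle at the
   start of each cyclic interval of J. *)
Definition starts J : {set 'Z_n} := [set j in J | j - 1 \notin J].

Lemma valid_starts J : valid J (starts J).
Proof.
by apply/validP=> j jJ; rewrite !inE addrK jJ andbF; split=> //; case: (_ \in J).
Qed.

(** Both words raise [starts J] to the same state, so uniqueness of raising words replaces an
    explicit sequence of commutations. *)
Lemma decr_cox J a b : decr_word J a -> decr_word J b -> cox_eq a b.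
Proof.
move=> da db; apply: (@up_unique _ _ _ (starts J)).
- by rewrite (decr_up _ da) valid_starts.
- by rewrite (decr_up _ db) valid_starts.
- by rewrite (decr_act da) ?(decr_act db) ?valid_starts.
- by rewrite (size_decr da) (size_decr db).
Qed.

Lemma decr_reduced J a : decr_word J a -> reduced_word (wprod a) a.
Proof. by move=> da; apply: (@up_reduced _ _ (starts J)); rewrite (decr_up _ da) valid_starts. Qed.

Definition dword J : seq 'Z_n := xget [::] (@decr_word n J).

Lemma dwordP J : J \proper [set: 'Z_n] -> decr_word J (dword J).
Proof. by move=> /decr_word_exists[a da]; apply: (xgetPex [::]); exists a. Qed.

Definition delt J : affSym n := wprod (dword J).

Lemma is_d_delt J w : J \proper [set: 'Z_n] -> is_d J w -> w = delt J.
Proof. by move=> /dwordP dJ [a da ->]; apply/wprodP; exact: decr_cox da dJ. Qed.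

Lemma delt_is_d J : J \proper [set: 'Z_n] -> is_d J (delt J).
Proof. by move=> /dwordP dJ; exists (dword J). Qed.

Lemma reduced_dword J : J \proper [set: 'Z_n] -> reduced_word (delt J) (dword J).
Proof. by move=> /dwordP/decr_reduced. Qed.

Lemma len_delt J : J \proper [set: 'Z_n] -> len (delt J) = #|J|.
Proof. by move=> pJ; rewrite -(reduced_dword pJ).2 (size_decr (dwordP pJ)). Qed.

Lemma raises_delt J S : J \proper [set: 'Z_n] -> raises (delt J) S = valid J S.
Proof. by move=> pJ; rewrite (raisesE _ (reduced_dword pJ)) (decr_up _ (dwordP pJ)). Qed.

Lemma actg_delt J S : J \proper [set: 'Z_n] -> valid J S -> actg (delt J) S = mv J S.
Proof. by move=> pJ vJ; rewrite (@actgE _ _ (dword J)) // (decr_act (dwordP pJ)). Qed.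

(** The two words raise the same state to the same target, so their letter counts agree, and these
    counts recover the sets. *)
Lemma delt_inj J J' : J \proper [set: 'Z_n] -> J' \proper [set: 'Z_n] ->
  delt J = delt J' -> J = J'.
Proof.
move=> pJ pJ' e; have dJ := dwordP pJ; have dJ' := dwordP pJ'.
have uJ : up (dword J) (starts J) by rewrite (decr_up _ dJ) valid_starts.
have uJ' : up (dword J') (starts J).
  by rewrite -(raisesE _ (reduced_dword pJ')) -e raises_delt // valid_starts.
have ea : actw (dword J) (starts J) = actw (dword J') (starts J).
  by apply: (cox_eq_act _ _).1; apply/wprodP.
have es : size (dword J) = size (dword J').
  by rewrite (reduced_dword pJ).2 (reduced_dword pJ').2 e.
apply/setP=> x; case: dJ => _ <- _; case: dJ' => _ <- _.
by rewrite -!has_pred1 !has_count (up_count_eq uJ uJ' ea es).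
Qed.

Lemma set0_proper : finset.set0 \proper [set: 'Z_n].
Proof. by rewrite properE finset.sub0set; apply/subsetPn; exists 0; rewrite inE. Qed.

Lemma delt0 : delt finset.set0 = 1%g.
Proof. by apply: len_eq0; rewrite len_delt ?cards0 // set0_proper. Qed.

End CyclicallyDecreasing.

(** * Recursion for affine Stanley functions *)

Section StanleyRecursion.
Variable n : nat.
Implicit Types (S T J : {set 'Z_n}) (u v w x y : affSym n).
Implicit Types (al : seq nat) (t : seq (affSym n)).

Lemma len_mul v w : (len (v * w)%g <= len v + len w)%N.
Proof.
have [va sv] := rwordP v; have [wa sw] := rwordP w.
by have := len_le_size (rword v ++ rword w); rewrite wprod_cat va wa size_cat sv sw.
Qed.

Lemma len_prod t : (len (\prod_(x <- t) x)%g <= \sum_(x <- t) len x)%N.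
Proof.
elim: t => [|x t IH]; first by rewrite !big_nil len1.
by rewrite !big_cons (leq_trans (len_mul _ _)) // leq_add2l.
Qed.

Definition divides J w : bool := len w == (len (w * (delt J)^-1)%g + #|J|)%N.

Definition right_factor J w r : bool :=
  [&& J \proper [set: 'Z_n], #|J| == r & divides J w].

Lemma cyc_factorizations_rcons w al r t x :
  cyc_factorizations w (rcons al r) (rcons t x) <->
  exists2 J, right_factor J w r & x = delt J /\
     cyc_factorizations (w * (delt J)^-1)%g al t.
Proof.
split=> [[cyc]|[J /and3P[pJ /eqP cJ /eqP dJ] [-> [cyc lt wt st]]]].
- rewrite map_rcons => /rcons_inj[lt lx] wt st.
  have [J pJ dJ] : cyc_decreasing x by apply: cyc; rewrite mem_rcons mem_head.
  have xJ := is_d_delt pJ dJ; have lJ := len_delt pJ.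
  move: wt st; rewrite -cats1 !big_cat !big_seq1 /= => wt st.
  have wx : (w * (delt J)^-1 = \prod_(y <- t) y)%g by rewrite wt xJ mulgK.
  (* Subadditivity of the length leaves no slack: once the whole factorization is length-additive,
     so is its prefix. *)
  have lprod : len (\prod_(y <- t) y)%g = (\sum_(y <- t) len y)%N.
    apply/eqP; rewrite eqn_leq len_prod /= -(leq_add2r (len x)) st wt.
    exact: len_mul.
  exists J; first by rewrite /right_factor pJ -lJ -xJ lx eqxx /divides wx lprod -lJ -xJ st /=.
  split=> //; split=> //; last by rewrite wx lprod.
  by move=> y yt; apply: cyc; rewrite mem_rcons inE yt orbT.
- split.
  + move=> y; rewrite mem_rcons inE => /orP[/eqP ->|]; last exact: cyc.
    by exists J => //; exact: delt_is_d.
  + by rewrite map_rcons lt len_delt // cJ.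
  + by rewrite -cats1 big_cat big_seq1 /= -wt mulgVK.
  + by rewrite -cats1 big_cat big_seq1 /= st len_delt // dJ.
Qed.

Lemma affStanley_rcons w al r :
  affStanley w (rcons al r) =
  \sum_(J | right_factor J w r) affStanley (w * (delt J)^-1)%g al.
Proof.
rewrite /affStanley -(big_morph Posz PoszD (erefl _)); congr Posz.
have fin := @finite_cyc_factorizations n.
set X := fset_set _.
have memF v be t : t \in fset_set (cyc_factorizations v be) <-> cyc_factorizations v be t.
  by rewrite in_fset_set // inE.
(* By [delt_inj] the last factor determines [J], so summing these indicators over [J] counts each
   factorization once. The default [1%g] is never met, since the exponent sequence is nonempty. *)
have Xl t : t \in X -> (\sum_(J | right_factor J w r) (last 1%g t == delt J))%N = 1%N.
  move/memF; case/lastP: t => [[_ /(congr1 size)]|t x].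
    by rewrite size_rcons.
  move/cyc_factorizations_rcons=> [J rJ [-> _]]; rewrite last_rcons (bigD1 J) //= eqxx.
  rewrite big1 // => J' /andP[/and3P[pJ' _ _] J'J]; case: eqP => // e.
  by rewrite (delt_inj _ pJ' e) ?eqxx // in J'J; case/and3P: rJ.
transitivity (\sum_(t <- X) \sum_(J | right_factor J w r) (last 1%g t == delt J))%N.
  rewrite big_seq (eq_bigr (fun=> 1%N)) => [|t]; last exact: Xl.
  by rewrite -big_seq sum1_size.
rewrite exchange_big /=; apply: eq_bigr => J rJ.
have -> : (\sum_(t <- X) (last 1%g t == delt J))%N =
    size [seq t <- X | last 1%g t == delt J].
  by rewrite size_filter -sum1_count [RHS]big_mkcond; apply: eq_bigr => t _; case: eqP.
transitivity (size (map (rcons^~ (delt J))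
    (fset_set (cyc_factorizations (w * (delt J)^-1)%g al)))); last by rewrite size_map.
apply: perm_size; apply: uniq_perm.
- exact/filter_uniq/fset_uniq.
- by rewrite map_inj_uniq ?fset_uniq // => t t' /rcons_inj[].
move=> t; rewrite mem_filter; apply/andP/mapP.
  move=> [/eqP tJ /memF]; case/lastP: t tJ => [_ [_ /(congr1 size)]|t x].
    by rewrite size_rcons.
  rewrite last_rcons => -> /cyc_factorizations_rcons[J' rJ' [e ct]].
  exists t => //; apply/memF.
  by rewrite (@delt_inj _ J J') //; [case/and3P: rJ | case/and3P: rJ'].
move=> [t' /memF ct ->]; rewrite last_rcons eqxx; split=> //.
by apply/memF/cyc_factorizations_rcons; exists J.
Qed.

Lemma affStanley_nil w : affStanley w [::] = (w == 1%g)%:Z.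
Proof.
rewrite /affStanley; congr Posz.
have -> : cyc_factorizations w [::] = (if w == 1%g then [set [::]] else set0)%classic.
  apply/predeqP => t; split=> [[_ /eqP + wt _]|].
    by rewrite -size_eq0 size_map size_eq0 => /eqP t0; rewrite t0 big_nil in wt *; rewrite wt eqxx.
  case: eqP => // -> ->; split=> //; first by rewrite big_nil.
  by rewrite big_nil len1.
by case: eqP => _; rewrite ?fset_set1 ?cardfs1 ?fset_set0 ?cardfs0.
Qed.

Lemma affStanley_homogeneous w al : affStanley w al != 0 -> sumn al = len w.
Proof.
rewrite /affStanley; case: (fset_0Vmem (fset_set (cyc_factorizations w al))) => [->|[t]].
  by rewrite cardfs0.
rewrite in_fset_set ?inE; last exact: finite_cyc_factorizations.
by move=> [_ <- _ <-] _; rewrite sumnE big_map.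
Qed.

End StanleyRecursion.

(** * Pieri operators *)

Section PieriOperators.
Variable n : nat.
Implicit Types (S T J : {set 'Z_n}) (u v w : affSym n) (al : seq nat) (phi : {set 'Z_n} -> int).

Definition pieri r phi S : int := \sum_(J | valid J S && (#|J| == r)) phi (mv J S).

(** The last exponent gives the outermost operator, because the rightmost factor is the first to act
    on the state. *)
Definition pieris al phi := foldl (fun psi r => pieri r psi) phi al.

Lemma pieris_rcons al r phi : pieris (rcons al r) phi = pieri r (pieris al phi).
Proof. by rewrite /pieris foldl_rcons. Qed.

Definition delta T S : int := (S == T)%:Z.

Lemma pieris_delta al phi S : pieris al phi S = \sum_T phi T * pieris al (delta T) S.
Proof.
elim/last_ind: al S => [|al r IH] S.
  rewrite (bigD1 S) //= /delta eqxx mulr1 big1 ?addr0 // => T TS.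
  by rewrite eq_sym (negbTE TS) mulr0.
rewrite pieris_rcons /pieri (eq_bigr _ (fun J _ => IH _)) exchange_big /=.
apply: eq_bigr => T _; rewrite -mulr_sumr; congr (_ * _).
by rewrite pieris_rcons.
Qed.

(** The empty state is a true exception: there the full set [J] is valid, each letter being preceded
    by another one and no site being occupied. *)
Lemma valid_proper J S : S != finset.set0 -> valid J S -> J \proper [set: 'Z_n].
Proof.
move=> /finset.set0Pn[s sS] /validP vJ; rewrite properT; apply/eqP => JT.
by have [] := vJ (s - 1); rewrite ?JT ?inE // subrK sS.
Qed.

Lemma mv_neq0 J S : S != finset.set0 -> valid J S -> mv J S != finset.set0.
Proof.
move=> S0 vJ; rewrite -(actg_delt (valid_proper S0 vJ) vJ) -card_gt0 card_actg.
by rewrite card_gt0.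
Qed.

Lemma pieris_delta_neq0 al S T : S != finset.set0 -> pieris al (delta T) S != 0 ->
  exists w, [/\ raises w S, actg w S = T & len w = sumn al].
Proof.
elim/last_ind: al S => [|al r IH] S S0.
  rewrite /pieris /= /delta; case: (eqVneq S T) => [<- _|]; last by rewrite eqxx.
  by exists 1%g; rewrite raises1 actg1 len1.
rewrite pieris_rcons /pieri => ne.
have [J /andP[vJ /eqP cJ] nJ] : exists2 J, valid J S && (#|J| == r) &
    pieris al (delta T) (mv J S) != 0.
  apply: contrapT => nex; case/negP: ne; rewrite big1 // => J vJ.
  by apply: contrapT => /eqP nJ; apply: nex; exists J.
have pJ := valid_proper S0 vJ; have rJ : raises (delt J) S by rewrite raises_delt.
have [w [rw aw lw]] := IH _ (mv_neq0 S0 vJ) nJ.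
rewrite -(actg_delt pJ vJ) in rw aw; exists (w * delt J)%g.
have [-> ->] := raises_mul rJ rw; rewrite actgM aw len_delt // lw cJ.
by rewrite -cats1 sumn_cat /= addn0.
Qed.

(** Both sides obey the same recursion on the last exponent. A right factor [d_J] of [w] is a valid
    move from [S]; conversely a valid move that can be completed to the target in the right degree
    comes from a right factor of [w], by uniqueness of raising elements. *)
Lemma affStanley_pieris w al S T : S != finset.set0 -> raises w S -> actg w S = T ->
  len w = sumn al -> affStanley w al = pieris al (delta T) S.
Proof.
elim/last_ind: al w S => [|al r IH] w S S0 rw aw lw.
  move/len_eq0: lw => w1; rewrite affStanley_nil /pieris /= /delta -aw w1 actg1.
  by rewrite !eqxx.
rewrite -cats1 sumn_cat /= addn0 in lw.
rewrite affStanley_rcons pieris_rcons /pieri big_mkcond [RHS]big_mkcond /=.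
apply: eq_bigr => J _; case: ifP => [|/negP nJ].
  move=> /and3P[pJ /eqP cJ /eqP dJ]; rewrite cJ eqxx andbT.
  set v := (w * _)%g in dJ *; have e : w = (v * delt J)%g by rewrite mulgVK.
  have lvJ : len (v * delt J)%g = (len v + len (delt J))%N by rewrite -e len_delt.
  move: rw aw; rewrite e raisesM // raises_delt // => /andP[vJ].
  rewrite actgM actg_delt // vJ => rv av.
  apply: IH => //; first exact: mv_neq0.
  by move: dJ; rewrite lw cJ => /addIn.
(* It remains to show that a valid move that is not a right factor contributes zero: a nonzero term
   would give [v] with [w = v * delt J]. *)
case: ifP => // /andP[vJ /eqP cJ]; apply/esym/eqP/negP => /negP.
have pJ := valid_proper S0 vJ; have rJ : raises (delt J) S by rewrite raises_delt.
move=> /(pieris_delta_neq0 (mv_neq0 S0 vJ))[v]; rewrite -actg_delt // => -[rv av lv].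
have [rvJ lvJ] := raises_mul rJ rv.
have e : w = (v * delt J)%g.
  by apply: (raises_unique rw rvJ); rewrite ?actgM ?av // lvJ len_delt // cJ lv.
by apply: nJ; rewrite /right_factor pJ cJ eqxx /divides e mulgK lvJ len_delt /=.
Qed.

End PieriOperators.

(** * Commutation of the Pieri operators *)

Section TransferMatrix.
Variables (A : comNzRingType) (T : finType).
Implicit Types (M : T -> T -> A) (Ms : seq (T -> T -> A)) (a b c : T) (t : seq T).

Definition kmul M N a b : A := \sum_c M a c * N c b.

Definition kprod Ms : T -> T -> A := foldr kmul (fun a b => (a == b)%:R) Ms.

Fixpoint path_weight Ms a t : A :=
  if Ms is M :: Ms' then
    if t is c :: t' then M a c * path_weight Ms' c t' else 1
  else 1.

Lemma big_tupleS (k : nat) (F : seq T -> A) :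
  \sum_(t : k.+1.-tuple T) F t = \sum_c \sum_(t : k.-tuple T) F (c :: t).
Proof.
rewrite pair_bigA /=.
rewrite (reindex (fun p : T * k.-tuple T => [tuple of p.1 :: p.2])) //=.
exists (fun t : k.+1.-tuple T => (thead t, [tuple of behead t])) => [[c t]|t] _ /=.
  by congr (_, _); apply: val_inj.
by rewrite -tuple_eta.
Qed.

Lemma kprod_paths Ms a b :
  kprod Ms a b = \sum_(t : (size Ms).-tuple T) (last a t == b)%:R * path_weight Ms a t.
Proof.
elim: Ms a => [|M Ms IH] a /=.
  by rewrite (big_pred1 [tuple]) ?mulr1 // => t; apply/esym/eqP/tuple0.
rewrite (big_tupleS _ (fun t => (last a t == b)%:R *
  (if t is c :: t' then M a c * path_weight Ms c t' else 1))).
rewrite /kmul; apply: eq_bigr => c _; rewrite IH mulr_sumr.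
by apply: eq_bigr => t _; rewrite mulrCA.
Qed.

Lemma path_weight_prod Ms a t : size t = size Ms ->
  path_weight Ms a t =
  \prod_(i < size Ms) nth (fun _ _ => 0) Ms i (nth a (a :: t) i) (nth a t i).
Proof.
elim: Ms a t => [|M Ms IH] a [|c t] //=; first by rewrite big_ord0.
move=> [st]; rewrite big_ord_recl /= IH //; congr (_ * _).
apply: eq_bigr => i _; rewrite add0n /=.
have it : (i < size t)%N by rewrite st.
by rewrite (set_nth_default a c it) -(set_nth_default a c (s := c :: t)) //= ltnW.
Qed.

(** A closed path is a labelling of the edges of the cycle, with [M i] placed at the site between
    the edges [i - 1] and [i]. Cyclic subtraction makes [i = 0] no exception. *)
Lemma kprod_trace (p : nat) (M : 'I_p.+2 -> T -> T -> A) :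
  \sum_a kprod [seq M i | i <- enum 'I_p.+2] a a =
  \sum_(f : {ffun 'I_p.+2 -> T}) \prod_(i < p.+2) M i (f (i - 1)) (f i).
Proof.
set Ms := map _ _; have sM : size Ms = p.+2 by rewrite size_map size_enum_ord.
under eq_bigr do rewrite kprod_paths sM.
rewrite exchange_big /=.
rewrite (reindex (fun f : {ffun 'I_p.+2 -> T} => [tuple f i | i < p.+2])); last first.
  exists (fun s : p.+2.-tuple T => [ffun i => tnth s i]) => [f|s] _.
    by apply/ffunP=> i; rewrite ffunE tnth_mktuple.
  by apply: eq_from_tnth => i; rewrite tnth_mktuple ffunE.
apply: eq_bigr => f _; set t := [tuple f i | i < p.+2].
have nthf a (i : 'I_p.+2) : nth a t i = f i by exact: nth_mktuple.
have tl a : last a t = f (- 1).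
  rewrite (last_nth a) size_tuple.
  have -> : - 1 = ord_max :> 'I_p.+2.
    by apply: val_inj; rewrite /= (@modn_small 1) // subn1 modn_small.
  exact: (nthf a ord_max).
rewrite (bigD1 (f (- 1))) // tl eqxx mul1r big1 => [|a af]; last first.
  by rewrite tl eq_sym (negbTE af) mul0r.
rewrite path_weight_prod; last by rewrite size_tuple sM.
rewrite sM [LHS]addr0; apply: eq_bigr => i _; rewrite nthf (nth_map ord0) ?size_enum_ord // nth_ord_enum.
congr (M i _ _); case: i => [[|j] ij] /=.
  by rewrite (_ : Ordinal ij = 0) ?sub0r //; apply: val_inj.
have jp : (j < p.+2)%N by rewrite ltnW.
rewrite (nthf _ (Ordinal jp)); congr (f _).
have -> : Ordinal ij = Ordinal jp + 1.
  by apply: val_inj; rewrite /= [in RHS]modn_small ?modn_small ?addn1 // modn_small.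
by rewrite addrK.
Qed.

Lemma kmul_id_r M a b : kmul M (fun a b => (a == b)%:R) a b = M a b.
Proof.
rewrite /kmul (bigD1 b) //= eqxx mulr1 big1 ?addr0 // => c cb.
by rewrite (negbTE cb) mulr0.
Qed.

Lemma kmulA M N P a b : kmul (kmul M N) P a b = kmul M (kmul N P) a b.
Proof.
rewrite /kmul; under eq_bigr do rewrite mulr_suml.
rewrite exchange_big /=; apply: eq_bigr => c _; rewrite mulr_sumr.
by apply: eq_bigr => d _; rewrite mulrA.
Qed.

Lemma ktraceC M N : \sum_a kmul M N a a = \sum_a kmul N M a a.
Proof.
rewrite /kmul exchange_big /=; apply: eq_bigr => a _.
by apply: eq_bigr => b _; rewrite mulrC.
Qed.

Lemma eq_kmul M M' N N' : M =2 M' -> N =2 N' -> kmul M N =2 kmul M' N'.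
Proof. by move=> eM eN a b; apply: eq_bigr => c _; rewrite eM eN. Qed.

(** The usual conjugation argument under the trace. Division is avoided: [R'] inverts [R] only up to
    the scalar [d], which stays as a factor on both sides. *)
Lemma ktrace_intertwined (I : Type) (s : seq I) (M M' : I -> T -> T -> A) R R' (d : A) :
  (forall i, kmul (M i) R =2 kmul R (M' i)) ->
  kmul R R' =2 (fun a b => d * (a == b)%:R) ->
  kmul R' R =2 (fun a b => d * (a == b)%:R) ->
  d * (\sum_a kprod (map M s) a a) = d * (\sum_a kprod (map M' s) a a).
Proof.
move=> MR RR' R'R.
have KR : kmul (kprod (map M s)) R =2 kmul R (kprod (map M' s)).
  elim: s => [|i s IH] a b /=.
    rewrite kmul_id_r /kmul (bigD1 a) //= eqxx mul1r big1 ?addr0 // => c ca.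
    by rewrite eq_sym (negbTE ca) mul0r.
  rewrite kmulA (eq_kmul (fun _ _ => erefl) IH) -kmulA (eq_kmul (MR i) (fun _ _ => erefl)).
  by rewrite kmulA.
have scal N Q : Q =2 (fun a b => d * (a == b)%:R) ->
    d * (\sum_a N a a) = \sum_a kmul N Q a a.
  move=> eQ; rewrite mulr_sumr; apply: eq_bigr => a _.
  rewrite /kmul (bigD1 a) //= eQ eqxx mulr1 big1 ?addr0 1?mulrC // => c ca.
  by rewrite eQ (negbTE ca) !mulr0.
rewrite (scal _ _ RR').
under eq_bigr do rewrite -kmulA (eq_kmul KR (fun _ _ => erefl)) kmulA.
rewrite ktraceC; under eq_bigr do rewrite kmulA.
by rewrite -(scal _ _ R'R).
Qed.

End TransferMatrix.

(** * The local Yang-Baxter relation for two successive moves *)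

Section YangBaxter.
Variable A : comNzRingType.
Implicit Types (x y : A) (p q : bool * bool) (s : bool).

Lemma big_bool2 (F : bool * bool -> A) :
  \sum_c F c = F (true, true) + F (true, false) + (F (false, true) + F (false, false)).
Proof.
transitivity (\sum_a \sum_b F (a, b)); last by rewrite !big_bool.
by rewrite pair_bigA; apply: eq_bigr => -[].
Qed.

(* Two consecutive Pieri moves seen at one site: [p] and [q] record which of the two
   moves cross the edges to the left and to the right of the site, [s] and [s'] its
   occupation before and after. *)
Definition local_ok s s' p q : bool :=
  let s1 := ~~ q.1 && (s || p.1) in
  [&& ~~ (p.1 && s), q.1 ==> (s || p.1), ~~ (p.2 && s1), q.2 ==> (s1 || p.2) &
      s' == (~~ q.2 && (s1 || p.2))].

(** Only the edge to the right of the site is weighed, so that round the cycle each crossing counts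
    once. *)
Definition local_weight x y s s' p q : A :=
  if local_ok s s' p q then (if q.1 then x else 1) * (if q.2 then y else 1) else 0.

(* The number-conserving solution, unique up to scaling, of the intertwining relations
   [yang_baxter]. *)
Definition Rmatrix x y p q : A :=
  match p, q with
  | (false, false), (false, false) | (true, false), (true, false) => y
  | (false, true), (true, false) => y - x
  | (false, true), (false, true) | (true, true), (true, true) => x
  | _, _ => 0
  end.

Lemma yang_baxter x y s s' :
  kmul (local_weight x y s s') (Rmatrix x y) =2
  kmul (Rmatrix x y) (local_weight y x s s').
Proof.
case: s; case: s' => -[[] []] [[] []]; rewrite /kmul !big_bool2 /local_weight /local_ok /=;
  rewrite ?mulr0 ?mul0r ?addr0 ?add0r ?mulr1 ?mul1r //.
- by rewrite mulrA.
- by rewrite (mulrC x) -mulrDr addrC subrK.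
- by rewrite subrK.
- by rewrite mulrA.
- by rewrite (mulrC x) -mulrDr addrC subrK.
- by rewrite mulrC.
- by rewrite -mulrDl subrK.
Qed.

Lemma Rmatrix_inv x y :
  kmul (Rmatrix x y) (Rmatrix y x) =2 (fun p q => (x * y) * (p == q)%:R).
Proof.
move=> [[] []] [[] []]; rewrite /kmul big_bool2 /=;
  rewrite ?mulr0 ?mul0r ?addr0 ?add0r ?mulr1 ?mul1r //.
- by rewrite mulrC.
- by rewrite mulrC -mulrDr addrA subrK subrr mulr0.
- by rewrite mulrC.
Qed.

End YangBaxter.

(** * Pairs of moves as a transfer matrix trace, and commutation *)

Section PieriCommute.
Variable n : nat.
Implicit Types (S T J : {set 'Z_n}) (phi : {set 'Z_n} -> int).

Definition two_moves S T (P : {set 'Z_n} * {set 'Z_n}) : bool :=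
  [&& valid P.1 S, valid P.2 (mv P.1 S) & mv P.2 (mv P.1 S) == T].

(** The requirement that the landing site [j + 1] be empty is read at that site instead of at [j];
    each site then sees only its two adjacent edges. *)
Lemma two_moves_local S T J J' :
  two_moves S T (J, J') =
  [forall x, local_ok (x \in S) (x \in T) (x - 1 \in J, x - 1 \in J') (x \in J, x \in J')].
Proof.
have validE K U : valid K U =
    [forall x, ~~ ((x - 1 \in K) && (x \in U)) && ((x \in K) ==> (x \in U) || (x - 1 \in K))].
  apply/validP/forallP => [vK x|vK j jK].
    apply/andP; split; last by apply/implyP => /vK[].
    by apply/negP=> /andP[/vK[+ _] xU]; rewrite subrK xU.
  have := vK (j + 1); rewrite addrK jK /= => /andP[-> _].
  by have := vK j; rewrite jK /= => /andP[].
apply/and3P/forallP => [[] | H].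
  rewrite !validE => /forallP v1 /forallP v2 /eqP <- x.
  have /andP[v11 v12] := v1 x; have /andP[v21 v22] := v2 x.
  by rewrite /local_ok /= v11 v12; move: v21 v22; rewrite !inE => -> -> /=.
split; rewrite ?validE; first by apply/forallP=> x; case/and5P: (H x) => /= -> ->.
  by apply/forallP=> x; rewrite !inE; case/and5P: (H x) => /= _ _ -> ->.
by apply/eqP/setP=> x; rewrite !inE; case/and5P: (H x) => /= _ _ _ _ /eqP ->.
Qed.

Definition move_gf (A : comNzRingType) (x y : A) S T : A :=
  \sum_(P | two_moves S T P) x ^+ #|P.1| * y ^+ #|P.2|.

Lemma move_gf_trace (A : comNzRingType) (x y : A) S T :
  move_gf x y S T =
  \sum_a kprod [seq local_weight x y (i \in S) (i \in T) | i <- enum 'Z_n] a a.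
Proof.
rewrite kprod_trace /move_gf.
rewrite (reindex (fun f : {ffun 'Z_n -> bool * bool} =>
  ([set z | (f z).1], [set z | (f z).2]))) /=; last first.
  exists (fun P : {set 'Z_n} * {set 'Z_n} => [ffun z => (z \in P.1, z \in P.2)]) => [f|[J J']] _.
    by apply/ffunP=> z; rewrite ffunE !inE; case: (f z).
  by congr (_, _); apply/setP=> z; rewrite !inE ffunE.
rewrite big_mkcond; apply: eq_bigr => f _; rewrite two_moves_local.
case: ifP => [/forallP H|/forallPn[z Hz]]; last first.
  rewrite (bigD1 z) //= [X in X * _](_ : _ = 0) ?mul0r // /local_weight.
  by rewrite ifN //; move: Hz; rewrite !inE; case: (f z) (f (z - 1)) => ? ? [].
rewrite -!sum1_card (big_morph _ (exprD x) (expr0 x)) (big_morph _ (exprD y) (expr0 y)) [X in X * _]big_mkcond.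
rewrite [X in _ * X]big_mkcond -big_split /=; apply: eq_bigr => z _.
rewrite /local_weight; have := H z; rewrite !inE.
by case: (f z) (f (z - 1)) => a b [c d] /= ->; rewrite !expr1.
Qed.

(* Conjugation by the R-matrix exchanges the two spectral parameters in every factor of
   the transfer matrix, hence leaves its trace unchanged. *)
Lemma move_gfC (A : idomainType) (x y : A) S T : x != 0 -> y != 0 ->
  move_gf x y S T = move_gf y x S T.
Proof.
move=> x0 y0; apply: (mulfI (mulf_neq0 x0 y0)); rewrite !move_gf_trace.
apply: (@ktrace_intertwined _ _ _ _ _ _ (Rmatrix x y) (Rmatrix y x)).
- by move=> i; exact: yang_baxter.
- exact: Rmatrix_inv.
- by rewrite mulrC; exact: Rmatrix_inv.
Qed.

Definition move_count r s S T : nat :=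
  #|[set P | two_moves S T P & (#|P.1| == r) && (#|P.2| == s)]|.

Lemma move_countC r s S T : move_count r s S T = move_count s r S T.
Proof.
(* Two independent indeterminates in a domain: [move_gfC] applies to them, and comparing one
   coefficient on its two sides gives the two counts. *)
pose x : {poly {poly int}} := 'X%:P; pose y : {poly {poly int}} := 'X.
have coefxy p q : (x ^+ p * y ^+ q)`_s`_r = ((p == r) && (q == s))%:R.
  rewrite /x /y -polyC_exp coefCM coefXn (eq_sym s); case: eqP => _.
    by rewrite mulr1 coefXn andbT eq_sym.
  by rewrite mulr0 coef0 andbF.
have coefyx p q : (y ^+ p * x ^+ q)`_s`_r = ((p == s) && (q == r))%:R.
  by rewrite mulrC coefxy andbC.
have cnt (Q : pred ({set 'Z_n} * {set 'Z_n})) :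
    \sum_(P | two_moves S T P) (Q P)%:R = (#|[set P | two_moves S T P & Q P]|)%:R :> int.
  rewrite -sum1_card natr_sum; under [RHS]eq_bigl do rewrite inE.
  by rewrite [RHS]big_mkcondr /=; apply: eq_bigr => P _; case: (Q P).
have x0 : x != 0 by rewrite polyC_eq0 polyX_eq0.
have y0 : y != 0 by rewrite polyX_eq0.
have := congr1 (fun f : {poly {poly int}} => f`_s`_r) (move_gfC S T x0 y0).
rewrite /move_gf !coef_sum; under eq_bigr do rewrite coefxy.
under [RHS]eq_bigr do rewrite coefyx.
by rewrite (cnt (fun P => (_ == r) && _)) (cnt (fun P => (_ == s) && _)) => /eqP; rewrite eqr_nat => /eqP.
Qed.

Lemma pieri_comp r s phi S :
  pieri r (pieri s phi) S = \sum_T phi T * (move_count r s S T)%:R.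
Proof.
rewrite /pieri pair_big_dep /=.
rewrite (partition_big (fun P => mv P.2 (mv P.1 S)) predT) //=.
apply: eq_bigr => T _; rewrite /move_count -sum1_card natr_sum mulr_sumr.
under [RHS]eq_bigl do rewrite inE.
apply: congr_big => //.
  move=> P; rewrite /two_moves; do 2!case: (valid _ _) => //=; rewrite ?andbF //=.
  by rewrite andbA andbC; do 3!case: (_ == _).
by move=> P; case/andP=> _ /eqP ->; rewrite mulr1.
Qed.

Lemma pieriC r s phi : pieri r (pieri s phi) = pieri s (pieri r phi).
Proof.
by apply/funext=> S; rewrite !pieri_comp; apply: eq_bigr => T _; rewrite move_countC.
Qed.

End PieriCommute.

(** * Cyclicity of the vacuum *)

Section Vacuum.
Variables (n m : nat).
Hypotheses (hn : (1 < n)%N) (m_gt0 : (0 < m)%N) (m_ltn : (m < n)%N).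
Implicit Types (x y j h : 'Z_n) (S T J : {set 'Z_n}) (phi : {set 'Z_n} -> int).

Lemma Zp_ltn x : (x < n)%N.
Proof. by have := ltn_ord x; rewrite [X in (_ < X)%N]Zp_cast. Qed.

Lemma card_Zmod : #|'Z_n| = n.
Proof. by rewrite card_ord Zp_cast. Qed.

Lemma Zp_card (a : nat) : (a <= n)%N -> #|[set x : 'Z_n | (x < a)%N]| = a.
Proof.
move=> an; rewrite -sum1_card; under eq_bigl do rewrite inE.
rewrite -(big_ord_widen _ (fun=> 1%N)); first by rewrite sum1_card card_ord.
by rewrite Zp_cast.
Qed.

Lemma Zp_natK (a : nat) : (a < n)%N -> nat_of_ord (a%:R : 'Z_n) = a.
Proof. by move=> an; rewrite val_Zp_nat // modn_small. Qed.

Lemma Zp_val_sub1 x : x != 0 -> nat_of_ord x = (nat_of_ord (x - 1)).+1.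
Proof.
move=> x0; have xgt0 : (0 < x)%N by rewrite lt0n; apply: contraNneq x0 => e; apply/eqP/val_inj.
have -> : x - 1 = (x.-1)%:R :> 'Z_n.
  by rewrite -{1}(natr_Zp x) -{1}(prednK xgt0) -natr1 addrK.
by rewrite Zp_natK prednK // ltnW // Zp_ltn.
Qed.

(* Distance from x to the rightmost hole n - m of the vacuum. *)
Definition dist x : nat := nat_of_ord (- m%:R - x).

Definition vac : {set 'Z_n} := [set x | (n - m <= dist x)%N].

Lemma dist_inj : injective dist.
Proof. by move=> x y /val_inj/addrI/oppr_inj. Qed.

Lemma dist_ltn x : (dist x < n)%N.
Proof. exact: Zp_ltn. Qed.

Lemma dist_succ x : (0 < dist x)%N -> dist x = (dist (x + 1)).+1.
Proof. by rewrite lt0n => dx; rewrite /dist opprD addrA -Zp_val_sub1. Qed.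

Lemma dist_pred x : ((dist x).+1 < n)%N -> dist (x - 1) = (dist x).+1.
Proof.
move=> dx; have := @dist_succ (x - 1); rewrite subrK; apply.
rewrite lt0n; apply: contraL dx => /eqP e; rewrite -leqNgt /dist.
have -> : - m%:R - x = -1 :> 'Z_n.
  have /val_inj e' : nat_of_ord (- m%:R - (x - 1)) = nat_of_ord (0 : 'Z_n) by [].
  by apply/eqP; rewrite -subr_eq0 -e' opprB opprK addrA addrAC -addrA.
have n0 : (0 < n)%N by rewrite ltnW.
have -> : -1 = (n.-1)%:R :> 'Z_n.
  by apply/eqP; rewrite eq_sym -addr_eq0 natr1 prednK // pchar_Zp.
by rewrite Zp_natK ?prednK.
Qed.

Lemma card_dist_ge (a : nat) : (a <= n)%N -> #|[set x | (a <= dist x)%N]| = (n - a)%N.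
Proof.
move=> an; have := cardsC [set x | (a <= dist x)%N].
suff -> : #|~: [set x | (a <= dist x)%N]| = a.
  by rewrite card_Zmod => /(congr1 (subn^~ a)); rewrite addnK.
rewrite -[RHS](Zp_card an) -(card_imset _ (can_inj (subKr (- m%:R : 'Z_n)))).
apply: eq_card => x; rewrite !inE; apply/imsetP/idP => [[y]|xa].
  by rewrite !inE -ltnNge => ya ->.
by exists (- m%:R - x); rewrite ?subKr // !inE -ltnNge /dist subKr.
Qed.

Lemma card_vac : #|vac| = m.
Proof. by rewrite card_dist_ge ?leq_subr // subKn // ltnW. Qed.

(** The occupied sites form one block, and only its right end can jump. This is where the
    $0$-Grassmannian condition comes from. *)
Lemma vac_start x : x \in vac -> x + 1 \notin vac -> x = 0.
Proof.
rewrite !inE -ltnNge => xv x1v; have nm : (0 < n - m)%N by rewrite subn_gt0.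
have := dist_succ (leq_trans nm xv) => e.
have dx : dist x = (n - m)%N by move: xv x1v e; clear; lia.
apply: dist_inj; rewrite dx /dist subr0.
have -> : - m%:R = (n - m)%:R :> 'Z_n.
  by rewrite natrB 1?ltnW // pchar_Zp // sub0r.
by rewrite Zp_natK // ltn_subrL m_gt0 ltnW.
Qed.

(** When a particle jumps right, a hole moves left and its distance grows by one, except for the
    jump out of the site at distance 0, where it wraps around. *)
Definition hole_energy S : nat := (\sum_(x | x \notin S) dist x)%N.

Lemma hole_energy_mv J S : valid J S -> (forall j, j \in J -> 0 < dist j)%N ->
  hole_energy (mv J S) = (hole_energy S + #|J|)%N.
Proof.
move=> /validP vJ dJ; rewrite /hole_energy.
rewrite (bigID (fun x => x \in J)) /=.
rewrite [in RHS](bigID (fun x => x - 1 \in J)) /= addnAC; congr (_ + _)%N; last first.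
  apply: eq_bigl => x; rewrite !inE negb_and negbK negb_or.
  case: (boolP (x \in J)) => [/vJ[_]|_] /=; last by rewrite andbT.
  by case: (x \in S); case: (_ \in J).
transitivity (\sum_(j in J) dist j)%N.
  by apply: eq_bigl => x; rewrite !inE; case: (x \in J); rewrite ?andbF.
have -> : (\sum_(x | (x \notin S) && ((x - 1)%R \in J)) dist x = \sum_(j in J) dist (j + 1)%R)%N.
  rewrite (reindex_inj (addIr (1 : 'Z_n))) /=; apply: eq_bigl => x.
  by rewrite addrK; case: (boolP (x \in J)) => [/vJ[->]|]; rewrite ?andbF.
rewrite -sum1_card.
by rewrite -big_split /=; apply: eq_bigr => j jJ; rewrite (dist_succ (dJ j jJ)) addn1.
Qed.


(** The number of holes already in vacuum position, packed against the site [- m]; equivalently the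
    least distance of a particle, with value [n] on the empty state. *)
Definition locked S : nat := find (fun t => - m%:R - t%:R \in S) (iota 0 n).

Lemma dist_site (t : nat) : (t < n)%N -> dist (- m%:R - t%:R) = t.
Proof. by move=> tn; rewrite /dist subKr Zp_natK. Qed.

Lemma dist_siteK x : - m%:R - (dist x)%:R = x.
Proof. by rewrite /dist natr_Zp subKr. Qed.

Lemma locked_ltn S : S != finset.set0 -> (locked S < n)%N.
Proof.
move=> /finset.set0Pn[x xS]; rewrite /locked -[X in (_ < X)%N](size_iota 0) -has_find.
by apply/hasP; exists (dist x); rewrite ?mem_iota ?dist_ltn ?dist_siteK.
Qed.

Lemma locked_notin S x : (dist x < locked S)%N -> x \notin S.
Proof.
move=> dx; have := before_find 0%N dx; rewrite nth_iota ?dist_ltn // add0n dist_siteK.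
by move=> ->.
Qed.

Lemma locked_in S x : S != finset.set0 -> dist x = locked S -> x \in S.
Proof.
move=> S0 dx; have lS := locked_ltn S0.
have : has (fun t => - m%:R - t%:R \in S) (iota 0 n) by rewrite has_find size_iota.
by move/(nth_find 0%N); rewrite -/(locked S) nth_iota // add0n -dx dist_siteK.
Qed.

Lemma locked_le S x : x \in S -> (locked S <= dist x)%N.
Proof. by move=> xS; rewrite leqNgt; apply: contraTN xS => /locked_notin. Qed.

Definition loose S : {set 'Z_n} := [set x | (x \notin S) && (locked S < dist x)%N].

(** Every loose hole is brought one step closer to the site [- m]; the move [loose S] takes the
    result back to [S]. *)
Definition pushed S : {set 'Z_n} :=
  [set x | (locked S <= dist x)%N && (x - 1 \notin loose S)].

Section Push.
Variable S : {set 'Z_n}.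
Hypothesis S0 : S != finset.set0.

Lemma loose_dist_gt0 j : j \in loose S -> (0 < dist j)%N.
Proof. by rewrite inE => /andP[_]; apply: leq_trans. Qed.

Lemma valid_loose : valid (loose S) (pushed S).
Proof.
apply/validP=> j jD; rewrite [j + 1 \in _]inE addrK jD andbF; split=> //.
by rewrite [j \in pushed S]inE; move: jD; rewrite [j \in _]inE => /andP[_ /ltnW ->]; case: (_ \in _).
Qed.

Lemma loose_proper : loose S \proper [set: 'Z_n].
Proof.
rewrite properT; apply/eqP => DT; have := finset.in_setT (- m%:R - (locked S)%:R : 'Z_n).
by rewrite -DT inE dist_site ?locked_ltn // ltnn andbF.
Qed.

Lemma mv_loose : mv (loose S) (pushed S) = S.
Proof.
apply/setP=> x; rewrite inE [x \in pushed S]inE.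
case: (boolP (x \in S)) => xS.
  rewrite [x \in loose S]inE xS /= (locked_le xS) /=; by case: (_ \in loose S).
case: (ltngtP (dist x) (locked S)) => dx.
- rewrite /= [x - 1 \in _]inE dist_pred ?andbF; last exact: leq_ltn_trans dx (locked_ltn S0).
  by rewrite ltnNge dx /= !andbF.
- by rewrite [x \in loose S]inE xS dx.
- by rewrite (locked_in S0 dx) in xS.
Qed.

Lemma card_pushed : #|pushed S| = #|S|.
Proof.
by rewrite -[in RHS]mv_loose -(actg_delt loose_proper valid_loose) card_actg.
Qed.

Lemma hole_energy_pushed : hole_energy S = (hole_energy (pushed S) + #|loose S|)%N.
Proof.
by rewrite -{1}mv_loose hole_energy_mv //; [exact: valid_loose | exact: loose_dist_gt0].
Qed.

Lemma valid_pushed_step J j : valid J (pushed S) -> j \in J ->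
  (dist (j + 1)%R < locked S)%N \/ j \in loose S.
Proof.
move=> /validP vJ /vJ[+ _]; rewrite inE addrK negb_and negbK -ltnNge.
by move=> /orP[]; [left | right].
Qed.

Lemma hole_energy_mv_pushed J : valid J (pushed S) -> #|J| = #|loose S| ->
  hole_energy (mv J (pushed S)) = hole_energy S.
Proof.
move=> vJ cJ; rewrite hole_energy_mv // ?cJ -?hole_energy_pushed // => j jJ.
have [dj|] := valid_pushed_step vJ jJ; last exact: loose_dist_gt0.
have := @dist_pred (j + 1); rewrite addrK => -> //.
exact: leq_ltn_trans dj (locked_ltn S0).
Qed.

(** Such a move uses some letter outside [loose S], which must land among the locked holes. For the
    one landing at the least distance, no further letter carries the particle on, so that locked
    hole gets filled. *)
Lemma locked_mv_pushed J : valid J (pushed S) -> #|J| = #|loose S| -> J != loose S ->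
  (locked (mv J (pushed S)) < locked S)%N.
Proof.
move=> vJ cJ JD; have /subsetPn[j0 j0J j0D] : ~~ (J \subset loose S).
  by apply: contraNN JD => sJD; rewrite eqEcard sJD cJ leqnn.
pose P j := (j \in J) && (j \notin loose S).
have Pj0 : P j0 by rewrite /P j0J.
case: (arg_minnP (fun j => dist (j + 1)) Pj0) => j /andP[jJ jD] jmin.
have dj : (dist (j + 1)%R < locked S)%N by case: (valid_pushed_step vJ jJ) => // j'; rewrite j' in jD.
have j1D : j + 1 \notin loose S by rewrite inE ltnNge ltnW // andbF.
apply: leq_ltn_trans dj; apply: locked_le; rewrite inE addrK jJ orbT andbT.
apply/negP=> j1J; have [dj2|] := valid_pushed_step vJ j1J; last by rewrite (negbTE j1D).
have := jmin (j + 1); rewrite /P j1J j1D => /(_ isT).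
(* At distance 0 the next site would be at distance [n - 1], too far to be locked. *)
case: (posnP (dist (j + 1))) => [d0|dpos]; last by rewrite (dist_succ dpos) ltnn.
have := @dist_pred (j + 1 + 1); rewrite addrK d0 => /(_ _); move=> H _.
by have := H (leq_ltn_trans dj2 (locked_ltn S0)).
Qed.

Lemma loose_eq0 : #|S| = m -> loose S = finset.set0 -> S = vac.
Proof.
move=> cS D0; have e : S = [set x | (locked S <= dist x)%N].
  apply/setP=> x; rewrite inE; apply/idP/idP => [/locked_le//|].
  rewrite leq_eqVlt => /orP[/eqP e|dx]; first exact: locked_in.
  by apply: contraPT D0 => xS /setP/(_ x); rewrite !inE xS dx.
have lS := locked_ltn S0; have := card_dist_ge (ltnW lS); rewrite -e cS => em.
rewrite e /vac em; apply/setP=> x; rewrite !inE subKn // ltnW //.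
Qed.

End Push.

End Vacuum.

(** * Reaching every state from the vacuum *)

Section Cyclicity.
Variables (n m : nat).
Hypotheses (hn : (1 < n)%N) (m_gt0 : (0 < m)%N) (m_ltn : (m < n)%N).
Implicit Types (S T J : {set 'Z_n}) (phi : {set 'Z_n} -> int).

(* Evaluation at [S] is evaluation at the vacuum after an operator of the centralizer
   of the Pieri operators, i.e. the vacuum generates the state space. *)
Definition reached S : Prop :=
  exists2 A : ({set 'Z_n} -> int) -> ({set 'Z_n} -> int),
    forall r phi, A (pieri r phi) = pieri r (A phi) &
    forall phi, phi S = A phi (vac n m).

Lemma pieri_sub_sum (I : finType) (P : pred I) r phi (psi : I -> {set 'Z_n} -> int) :
  pieri r (fun T => phi T - \sum_(i | P i) psi i T) =
  (fun T => pieri r phi T - \sum_(i | P i) pieri r (psi i) T).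
Proof.
apply/funext=> T; rewrite /pieri big_split /= sumrN; congr (_ - _).
by rewrite exchange_big.
Qed.

Lemma card_state_neq0 S : #|S| = m -> S != finset.set0.
Proof. by move=> cS; rewrite -card_gt0 cS. Qed.

(** The Pieri operator of size [#|loose m S|], evaluated at [pushed m S], has the value at [S] among
    its terms. The starting state has smaller energy, and the other targets have the same energy as
    [S] but fewer locked holes, so solving for the value at [S] closes the induction. *)
Lemma all_reached S : #|S| = m -> reached S.
Proof.
(* Since [locked] is below [n], this number encodes the lexicographic order on energy and locked
   holes. *)
have [k] := ubnP (hole_energy m S * n + locked m S)%N.
elim: k S => // k IH S; rewrite ltnS => le_k cS.
have S0 := card_state_neq0 cS.
case: (eqVneq (loose m S) finset.set0) => [/(loose_eq0 hn S0 cS) ->|D0].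
  by exists id.
have cN : #|pushed m S| = m by rewrite card_pushed.
have N0 := card_state_neq0 cN.
have lN := locked_ltn m hn N0; have lS := locked_ltn m hn S0.
have [A Ar Av] : reached (pushed m S).
  apply: IH => //; apply: leq_trans le_k; rewrite (hole_energy_pushed m hn S0).
  rewrite -card_gt0 in D0; rewrite mulnDl -addnA -addnS leq_add2l.
  by rewrite (leq_trans lN) // (leq_trans _ (leq_addr _ _)) // leq_pmull.
pose P J := (valid J (pushed m S) && (#|J| == #|loose m S|)) && (J != loose m S).
have other J : P J -> reached (mv J (pushed m S)).
  move=> /andP[/andP[vJ /eqP cJ] nJ]; apply: IH; last first.
    by rewrite -(actg_delt (valid_proper N0 vJ) vJ) card_actg.
  apply: leq_trans le_k; rewrite (hole_energy_mv_pushed hn S0 vJ cJ) ltn_add2l.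
  exact: (locked_mv_pushed hn S0 vJ cJ nJ).
have /choice[B Bprop] : forall J, exists B : ({set 'Z_n} -> int) -> {set 'Z_n} -> int,
    P J -> (forall r phi, B (pieri r phi) = pieri r (B phi)) /\
           (forall phi, phi (mv J (pushed m S)) = B phi (vac n m)).
  move=> J; case: (boolP (P J)) => [/other[BJ B1 B2]|_]; last by exists id.
  by exists BJ.
exists (fun phi T => A (pieri #|loose m S| phi) T - \sum_(J | P J) B J phi T).
  move=> r phi; rewrite pieri_sub_sum; apply/funext=> T.
  rewrite pieriC Ar; congr (_ - _).
  by apply: eq_bigr => J /Bprop[-> _].
move=> phi; rewrite -Av {1}/pieri (bigD1 (loose m S)) /= ?valid_loose ?eqxx // mv_loose //.
rewrite (eq_bigr (fun J => B J phi (vac n m))) => [|J /Bprop[_ ->]] //.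
by rewrite addrK.
Qed.

End Cyclicity.

(** * Linear independence of affine Schur functions *)

Section Grassmannian.
Variable n : nat.
Hypothesis hn : (1 < n)%N.
Implicit Types (i j x y : 'Z_n) (a b : seq 'Z_n) (J : {set 'Z_n}) (u v w : affSym n).

(** A general [i] is needed because removing a maximal right factor shifts [i] to [i - 1]. *)
Definition grassmannian i w : Prop :=
  forall a j, reduced_word w (rcons a j) -> j = i.

Definition cinterval i (r : nat) : {set 'Z_n} := [set x | (nat_of_ord (x - i)%R < r)%N].

Lemma card_cinterval i r : (r <= n)%N -> #|cinterval i r| = r.
Proof.
move=> rn; rewrite -[RHS](Zp_card hn rn).
rewrite -(card_imset _ (addIr i)); apply: eq_card => x.
rewrite !inE; apply/idP/imsetP => [xr|[y]]; last by rewrite inE => yr ->; rewrite addrK.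
by exists (x - i); rewrite ?inE ?subrK.
Qed.

Lemma cinterval_proper i r : (r < n)%N -> cinterval i r \proper [set: 'Z_n].
Proof.
move=> rn; rewrite properT; apply/eqP => /(congr1 (fun J : {set 'Z_n} => #|J|)).
rewrite cardsT card_Zmod // card_cinterval 1?ltnW // => e.
by rewrite e ltnn in rn.
Qed.

Lemma Zp_addn_inj i p q : (p < n)%N -> (q < n)%N -> i + p%:R = i + q%:R -> p = q.
Proof.
by move=> pn qn /addrI /(congr1 (@nat_of_ord _)); rewrite !Zp_natK.
Qed.

Fixpoint dec_run i (r : nat) : seq 'Z_n :=
  if r is r'.+1 then i + r'%:R :: dec_run i r' else [::].

Lemma size_dec_run i r : size (dec_run i r) = r.
Proof. by elim: r => //= r ->. Qed.

Lemma dec_runD i s t : dec_run i (s + t) = dec_run (i + t%:R) s ++ dec_run i t.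
Proof. by elim: s => //= s ->; rewrite -addrA -natrD addnC. Qed.

Lemma mem_dec_run i p s x : x \in dec_run (i + p%:R) s ->
  exists2 q, (p <= q < p + s)%N & x = i + q%:R.
Proof.
elim: s => //= s IH; rewrite inE => /orP[/eqP ->|/IH[q /andP[pq qs] ->]].
  by exists (p + s)%N; rewrite ?leq_addr ?addnS ?leqnn // natrD addrA.
by exists q => //; rewrite pq addnS ltnS ltnW.
Qed.

Lemma decr_cons_intro J a j : decr_word J a -> j \notin J -> j + 1 \notin J ->
  decr_word (j |: J) (j :: a).
Proof.
case=> ua aJ idx jJ j1J; have ja : j \notin a by rewrite aJ.
split; [by rewrite /= ja | by move=> x; rewrite !inE aJ |].
move=> x; rewrite !inE /= (eq_sym j) (eq_sym j x); case: (eqVneq x j) => [->|xj] /=.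
  by rewrite (negbTE (Zp_add1_neq j)) /= (negbTE j1J).
move=> xJ; case: eqVneq => [//|_] /= x1J; rewrite ltnS; exact: idx.
Qed.

Lemma cinterval_nat i q r : (q < n)%N -> (i + q%:R \in cinterval i r) = (q < r)%N.
Proof. by move=> qn; rewrite inE addrC addKr Zp_natK. Qed.

Lemma decr_dec_run i r : (r < n)%N -> decr_word (cinterval i r) (dec_run i r).
Proof.
elim: r => [|r IH] rn; first by split=> // x; rewrite !inE.
have -> : cinterval i r.+1 = (i + r%:R) |: cinterval i r.
  apply/setP=> x; rewrite !inE ltnS leq_eqVlt (addrC i r%:R) -subr_eq; congr (_ || _).
  apply/eqP/eqP => [<-|->]; first by rewrite natr_Zp.
  by rewrite Zp_natK // ltnW.
have rn' := ltnW rn.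
apply: decr_cons_intro; first exact: IH.
  by rewrite cinterval_nat // ltnn.
by rewrite -addrA natr1 cinterval_nat // ltnNge leqnSn.
Qed.

Lemma right_factor_reduced J u r a b : right_factor J u r ->
  reduced_word (u * (delt J)^-1)%g a -> decr_word J b -> reduced_word u (a ++ b).
Proof.
move=> /and3P[pJ _ /eqP dJ] ra db.
have eb : delt J = wprod b by apply/esym/is_d_delt => //; exists b.
have rb : reduced_word (delt J) b by rewrite eb; exact: decr_reduced db.
rewrite -(mulgVK (delt J) u); apply: (reduced_mul ra rb).
by rewrite mulgVK len_delt.
Qed.

(** The first site of any cyclic interval of [J] can be written last in a reduced word of [u], so it
    must be [i]: there is only one interval. *)
Lemma grassmannian_right_factor i u J r : grassmannian i u -> right_factor J u r ->
  J = cinterval i r.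
Proof.
move=> gu rJ; have /and3P[pJ /eqP cJ _] := rJ.
have step x : x \in J -> x != i -> x - 1 \in J.
  move=> xJ; apply: contraNT => xNJ; apply/eqP.
  have pJx : J :\ x \proper [set: 'Z_n] := sub_proper_trans (finset.subD1set _ _) pJ.
  have : decr_word J (rcons (dword (J :\ x)) x).
    rewrite -{1}(finset.setD1K xJ); apply: decr_rcons_intro; first exact: dwordP.
      by rewrite !inE eqxx.
    by rewrite !inE (negbTE xNJ) andbF.
  move/(right_factor_reduced rJ (rwordP _)); rewrite -rcons_cat; exact: gu.
have down s x : x \in J -> (s <= nat_of_ord (x - i)%R)%N -> x - s%:R \in J.
  elim: s => [|s IH] xJ sx; first by rewrite subr0.
  rewrite -natr1 opprD addrA; apply: step; first by rewrite IH // ltnW.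
  apply: contraTneq sx => e; rewrite -leqNgt -e opprB addrCA subrr addr0 val_Zp_nat //.
  exact: leq_mod.
have rn : (r <= n)%N by have := max_card (mem J); rewrite card_Zmod // cJ.
apply/eqP; rewrite eqEcard card_cinterval // cJ leqnn andbT; apply/fintype.subsetP=> x xJ.
rewrite inE ltnNge; apply/negP=> rx.
have : (#|cinterval i (nat_of_ord (x - i)%R).+1| <= #|J|)%N.
  apply: fintype.subset_leq_card; apply/fintype.subsetP=> y; rewrite inE ltnS => yx.
  have -> : y = x - ((nat_of_ord (x - i)%R) - (nat_of_ord (y - i)%R))%:R.
    by rewrite natrB // !natr_Zp (opprB y) addrA subrK subKr.
  by apply: down => //; exact: leq_subr.
by rewrite card_cinterval ?Zp_ltn // cJ ltnNge rx.
Qed.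

End Grassmannian.

(** * Independence by peeling off maximal cyclically decreasing factors *)

Section LinearIndependence.
Variable n : nat.
Hypothesis hn : (1 < n)%N.
Implicit Types (i j x y : 'Z_n) (a b : seq 'Z_n) (J : {set 'Z_n}) (u v w : affSym n).

Lemma reduced_right_factor J u a b : J \proper [set: 'Z_n] -> decr_word J b ->
  reduced_word u (a ++ b) -> right_factor J u #|J|.
Proof.
move=> pJ db rab; have [eu su] := rab.
have eb : delt J = wprod b by apply/esym/is_d_delt => //; exists b.
rewrite /right_factor pJ eqxx /divides -eu eb wprod_cat mulgK -wprod_cat eu.
by rewrite -su size_cat (size_decr db) (reduced_catl rab).2 eqxx.
Qed.

(** Suppose the quotient ends in [j = i + t] with [t < n - 1]. If [t = r], the run extends, against
    maximality. If [t > r], the letter [j] commutes to the end of [u]. If [t = r - 1], it cancels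
    against the run. If [t < r - 1], a braid relation inside the run sends [j + 1] to the end. Every
    case is impossible. *)
Lemma grassmannian_quotient i u r : grassmannian i u -> (0 < r < n)%N ->
  right_factor (cinterval i r) u r ->
  ((r.+1 < n)%N -> ~~ right_factor (cinterval i r.+1) u r.+1) ->
  grassmannian (i - 1) (u * (delt (cinterval i r))^-1)%g.
Proof.
move=> gu /andP[r0 rn] rf maxr b j rb.
have red := right_factor_reduced rf rb (decr_dec_run hn i rn).
set t := nat_of_ord (j - i); have jt : j = i + t%:R by rewrite -(Zp_eq_add_nat j i).
have tn : (t < n)%N by exact: Zp_ltn.
have n0 : (0 < n)%N by rewrite ltnW.
have iN1 : i - 1 = i + (n.-1)%:R.
  by congr (_ + _); apply/eqP; rewrite eq_sym -addr_eq0 natr1 prednK // pchar_Zp.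
case: (eqVneq t n.-1) => [tn1|tn1]; first by rewrite jt tn1 iN1.
have {}tn1 : (t.+1 < n)%N by move: tn tn1 n0; clear; lia.
have iadd q : (q < n)%N -> i + q%:R = i -> q = 0%N.
  by move=> qn e; apply: (Zp_addn_inj hn (i := i) qn n0); rewrite e addr0.
have j1 : j + 1 = i + (t.+1)%:R by rewrite jt -addrA natr1.
have notin p s q : (q < n)%N -> (p + s <= n)%N -> ~~ (p <= q < p + s)%N ->
    i + q%:R \notin dec_run (i + p%:R) s.
  move=> qn psn nq; apply/negP=> /mem_dec_run[q' /andP[pq qs] e].
  by move: nq; rewrite (Zp_addn_inj hn qn (leq_trans qs psn) e) pq qs.
have jN1 p s : (p + s < n)%N -> ~~ (p <= t.-1 < p + s)%N || (t == 0%N) ->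
    j - 1 \notin dec_run (i + p%:R) s.
  move=> psn; case: (posnP t) => [t0 _|tgt /=].
    rewrite jt t0 addr0 iN1; apply: notin; [by rewrite prednK | exact: ltnW |].
    by move: psn n0; clear; lia.
  rewrite orbF => nq; rewrite jt -(prednK tgt) -natr1 addrA addrK.
  by apply: notin; [exact: leq_ltn_trans (leq_pred _) tn | exact: ltnW |].
exfalso; case: (ltngtP t r) => tr.
- case: (eqVneq t.+1 r) => [tr1|tr1].
    move: red; rewrite -tr1 /= -jt -cats1 -!catA => -[eu su].
    have := len_le_size (b ++ dec_run i t).
    have -> : wprod (b ++ dec_run i t) = u.
      rewrite -eu; apply/wprodP; apply: cox_catl; apply: cox_sym.
      exact: (@cox_catr _ [:: j; j] [::] _ (cox_invol j)).
    by rewrite -su !size_cat /= -!addSnnS; clear; lia.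
  have {}tr1 : (t.+2 <= r)%N by move: tr tr1; clear; lia.
  have [s rs] : exists s, r = (s + t.+2)%N by exists (r - t.+2)%N; rewrite subnK.
  have n2 : (2 < n)%N by move: tr1 rn; clear; lia.
  have red' : reduced_word u (rcons (b ++ dec_run (i + t.+2%:R) s ++ [:: j + 1; j] ++ dec_run i t) (j + 1)).
    apply: reduced_cox red; last first.
      by rewrite rs dec_runD !size_cat !size_rcons !size_cat /= !size_dec_run; clear; lia.
    rewrite rs dec_runD /= -j1 -jt -cats1 -catA !rcons_cat; apply: cox_catl.
    set above := dec_run (i + t.+2%:R) s.
    have comm : cox_eq (j :: above) (rcons above j).
      apply: cox_comm_seq; first by rewrite j1 notin //; move: rs rn; clear; lia.
      by apply: jN1; move: rs rn; clear; lia.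
    apply: cox_trans (cox_catr ([:: j + 1; j] ++ dec_run i t) comm) _; rewrite cat_rcons.
    apply: cox_catl; apply: cox_trans (cox_catr (dec_run i t) (cox_braid j n2)) _.
    apply: (cox_catl [:: j + 1; j]).
    apply: cox_comm_seq; have := notin 0%N t; rewrite addr0 => nt.
      by rewrite j1 -addrA natr1 nt //; move: rs rn; clear; lia.
    by rewrite addrK jt nt //; move: rs rn; clear; lia.
  by have := gu _ _ red'; rewrite j1 => /iadd; move: tn1; clear; lia.
- have red' : reduced_word u (rcons (b ++ dec_run i r) j).
    apply: reduced_cox red; last by rewrite size_cat !size_rcons size_cat addSn.
    rewrite -cats1 -catA rcons_cat; apply: cox_catl; apply: cox_comm_seq.
      by rewrite j1; have := notin 0%N r t.+1; rewrite addr0; apply; rewrite // ?add0n; move: tr rn; clear; lia.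
    by have := jN1 0%N r; rewrite addr0; apply; rewrite // ?add0n; move: tr rn; clear; lia.
  by have := gu _ _ red'; rewrite jt => /(iadd _ tn) t0; rewrite t0 in tr.
- have r1n : (r.+1 < n)%N by rewrite -tr.
  have := maxr r1n; rewrite -[X in right_factor _ _ X](card_cinterval hn i (ltnW r1n)).
  move/negP; apply; apply: (reduced_right_factor (a := b)); first exact: cinterval_proper.
    exact: decr_dec_run.
  by move: red; rewrite -cats1 -catA /= -tr -jt.
Qed.

(* Extracting the last exponent [r], chosen maximal, kills the [F_u] without a right
   factor [d_J] of size [r] and sends the others to the Stanley functions of
   distinct [(i - 1)]-Grassmannian elements of smaller length. *)
Lemma affStanley_independent (k : nat) i (L : seq (affSym n)) (c : affSym n -> int) :
  uniq L -> {in L, forall u, grassmannian i u} -> {in L, forall u, (len u < k)%N} ->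
  (forall al, \sum_(u <- L) c u * affStanley u al = 0) ->
  {in L, forall u, c u = 0}.
Proof.
elim: k i L c => [|k IH] i L c uL gL lL sL u0 u0L; first by have := lL _ u0L.
apply: contrapT => /eqP cu0.
pose Q r := (r < n)%N && has (fun u => (c u != 0) && right_factor (cinterval i r) u r) L.
have Q0 : exists r, Q r.
  exists 0%N; rewrite /Q ltnW // 1?ltnW //; apply/hasP; exists u0 => //; rewrite cu0 /=.
  have -> : cinterval i 0 = finset.set0 by apply/setP=> x; rewrite !inE.
  by rewrite /right_factor set0_proper cards0 /divides delt0 invg1 mulg1 cards0 addn0 !eqxx.
have Qb r : Q r -> (r <= n)%N by move=> /andP[/ltnW].
case: (ex_maxnP Q0 Qb) => r /andP[rn /hasP[u1 u1L /andP[cu1 rf1]]] rmax.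
have nomore u : u \in L -> c u != 0 -> forall r', (r < r')%N -> (r' < n)%N ->
    ~~ right_factor (cinterval i r') u r'.
  move=> uL' cu r' rr' r'n; apply/negP => rf; have := rmax r'; rewrite leqNgt rr' => H.
  suff /H : Q r' by [].
  by rewrite /Q r'n; apply/hasP; exists u => //; rewrite cu.
have expand u al : u \in L -> affStanley u (rcons al r) =
   if right_factor (cinterval i r) u r
   then affStanley (u * (delt (cinterval i r))^-1)%g al else 0.
  move=> uL'; rewrite affStanley_rcons; case: ifP => [rf|/negP nrf].
    rewrite (big_pred1 (cinterval i r)) // => J; apply/idP/eqP => [|-> //].
    exact: grassmannian_right_factor (gL _ uL').
  by rewrite big1 // => J rf; case: nrf; rewrite -(grassmannian_right_factor hn (gL _ uL') rf).
(* If the maximum is 0, no [u] with nonzero coefficient ends in a letter, so all of them are [1%g]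
   and the constant term of the relation decides. *)
case: (posnP r) => [r0|rpos].
  have one u : u \in L -> c u != 0 -> u = 1%g.
    move=> uL' cu; apply: contrapT => u1'.
    have [a [ea sa]] := reduced_word_exists u; case/lastP: a ea sa => [|a j] ea sa.
      by apply: u1'; rewrite -ea /wprod big_nil.
    have ji := gL _ uL' _ _ (conj ea sa); have := nomore u uL' cu 1%N; rewrite r0 => /(_ isT hn).
    rewrite -[X in right_factor _ _ X](card_cinterval hn i (ltnW hn)) => /negP; apply.
    apply: (reduced_right_factor (a := a)); first exact: cinterval_proper.
      exact: decr_dec_run.
    by rewrite /= addr0 cats1 -ji; split.
  have := sL [::]; rewrite (bigD1_seq u0) //= big1_seq => [|u /andP[uu0 uL']].
    rewrite addr0 affStanley_nil (introT eqP (one u0 u0L cu0)) mulr1 => /eqP.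
    exact/negP.
  case: (eqVneq (c u) 0) => [->|cu]; first by rewrite mul0r.
  by rewrite (one u0 u0L cu0) (one u uL' cu) eqxx in uu0.
set d := delt (cinterval i r).
pose L' := [seq (u * d^-1)%g | u <- L & (c u != 0) && right_factor (cinterval i r) u r].
have : c ((u1 * d^-1) * d)%g = 0.
  apply: (IH (i - 1) L' (fun v => c (v * d)%g)).
  - by rewrite map_inj_uniq ?filter_uniq // => x y /mulIg.
  - move=> v /mapP[u]; rewrite mem_filter => /andP[/andP[cu rf] uL'] ->.
    apply: grassmannian_quotient (gL _ uL') _ rf _; first by rewrite rpos.
    exact: nomore.
  - move=> v /mapP[u]; rewrite mem_filter => /andP[/andP[cu rf] uL'] ->.
    have := lL u uL'; case/and3P: rf => _ /eqP cr /eqP ->; rewrite cr ltnS.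
    by apply: leq_trans; rewrite -addn1 leq_add2l.
  - move=> al; rewrite big_map big_filter -[RHS](sL (rcons al r)) big_mkcond /=.
    rewrite big_seq [RHS]big_seq; apply: eq_bigr => u uL'.
    rewrite expand // mulgVK; case: ifP; first by move=> /andP[_ ->].
    by move/negbT; rewrite negb_and negbK => /orP[/eqP ->|/negbTE ->]; rewrite ?mul0r ?mulr0.
  - by apply/mapP; exists u1; rewrite // mem_filter cu1 rf1.
by rewrite mulgVK => /eqP; exact/negP.
Qed.

End LinearIndependence.

(** * 321-avoiding elements *)

Section Avoiding.
Variable n : nat.
Implicit Types (i j x y e f : 'Z_n) (a b s p q : seq 'Z_n) (S T J : {set 'Z_n}) (u v w : affSym n).

Definition interleaved a : Prop := forall i s1 s2 s3,
  a = s1 ++ i :: s2 ++ i :: s3 -> i \notin s2 -> (i + 1 \in s2) && (i - 1 \in s2).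

Lemma interleaved_cons i a : interleaved (i :: a) -> interleaved a.
Proof. by move=> ia j s1 s2 s3 ea; apply: (ia j (i :: s1) s2 s3); rewrite ea. Qed.

Lemma not_reduced_square w a b i : ~ reduced_word w (a ++ [:: i; i] ++ b).
Proof.
move=> [ew sw]; have := len_le_size (a ++ b).
have -> : wprod (a ++ b) = w.
  rewrite -ew; apply/wprodP; apply: cox_catl; apply: cox_sym.
  exact: (cox_catr b (cox_invol i)).
by rewrite -sw !size_cat /=; clear; lia.
Qed.

Lemma cox_comm_seqr i a b : i + 1 \notin a -> i - 1 \notin a ->
  cox_eq (i :: a ++ b) (a ++ i :: b).
Proof. by move=> i1 i2; rewrite -cat_rcons; apply: (cox_catr b (cox_comm_seq i1 i2)). Qed.

Lemma mem_twice f s : f \in s ->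
  (exists p q, [/\ s = p ++ f :: q, f \notin p & f \notin q]) \/
  (exists p q r, s = p ++ f :: q ++ f :: r /\ f \notin q).
Proof.
move=> /last_occurrence[s1 [r [-> fr]]].
case: (boolP (f \in s1)) => [/last_occurrence[p [q [-> fq]]]|fs1].
  by right; exists p, q, r; rewrite -catA.
by left; exists s1, r.
Qed.

Lemma avoids321_no_hat w a b i f : avoids321 w -> f = i + 1 \/ f = i - 1 -> (2 < n)%N ->
  ~ reduced_word w (a ++ [:: i; f; i] ++ b).
Proof.
move=> aw [-> _|-> n2 red]; first exact: aw.
apply: (aw a b (i - 1)); apply: reduced_cox red; last by rewrite !size_cat.
apply: cox_catl; apply: cox_catr; apply: cox_sym.
by have := cox_braid (i - 1) n2; rewrite subrK.
Qed.

(** Induction on the gap, supposing [i + e] missing from it. If [i - e] is missing too, the two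
    letters [i] meet and the word is not reduced; if [i - e] occurs once, a forbidden factor
    appears; if it occurs twice, the smaller gap between two successive occurrences contains [i] by
    induction. *)
Lemma avoids321_interleaved w a : avoids321 w -> reduced_word w a -> interleaved a.
Proof.
move=> aw ra i s1 s2 s3; have [k] := ubnP (size s2).
elim: k i s1 s2 s3 => // k IH i s1 s2 s3; rewrite ltnS => s2k ea is2.
have key e : e = 1 \/ e = - 1 -> i + e \in s2.
  move=> he; apply: contrapT => /negP ie.
  have ends s : i + e \notin s -> i - e \notin s -> i + 1 \notin s /\ i - 1 \notin s.
    by case: he => ->; rewrite ?opprK.
  have fe : i - e + e = i by rewrite subrK.
  case: (boolP (i - e \in s2)) => [fs2|ie']; last first.
    have [i1 i2] := ends _ ie ie'.
    apply: (@not_reduced_square w (s1 ++ s2) s3 i); apply: reduced_cox ra.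
      by rewrite ea -catA; apply: cox_catl; exact: cox_comm_seqr.
    by rewrite ea /=; do ![rewrite size_cat /=]; clear; lia.
  case: (mem_twice fs2).
  - move=> [p [q [es2 fp fq]]]; move: ie; rewrite es2 mem_cat inE !negb_or.
    move=> /and3P[ip ief iq]; have [ip1 ip2] := ends _ ip fp; have [iq1 iq2] := ends _ iq fq.
    (* One of [i + e] and [i - e] lies in the gap and the other does not, whereas they coincide for
       [n <= 2]. *)
    have n2 : (2 < n)%N.
      rewrite ltnNge; apply: contraNN ief => n2; rewrite (inj_eq (addrI i)).
      apply/eqP/val_inj; case: he => ->; rewrite ?opprK;
        by case: (n) n2 => [|[|[|]]].
    have nb : i - e = i + 1 \/ i - e = i - 1 by case: he => ->; rewrite ?opprK; [right | left].
    apply: (@avoids321_no_hat w (s1 ++ p) (q ++ s3) i _ aw nb n2); apply: reduced_cox ra.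
      rewrite ea es2 -!catA; apply: cox_catl => /=.
      apply: cox_trans (cox_comm_seqr _ ip1 ip2) _; apply: cox_catl.
      apply: (cox_catl [:: i; i - e]); apply: cox_sym.
      exact: cox_comm_seqr.
    by rewrite ea es2 /=; do ![rewrite size_cat /=]; clear; lia.
  - move=> [p [q [r [es2 fq]]]].
    have /andP[f1 f2] : (i - e + 1 \in q) && (i - e - 1 \in q).
      apply: (IH (i - e) (s1 ++ i :: p) q (r ++ i :: s3)) => //.
        by apply: leq_trans s2k; rewrite es2 /=; do ![rewrite size_cat /=]; clear; lia.
      by rewrite ea es2 /=; do ![rewrite -catA /=].
    have iq : i \in q by case: he f1 f2 fe => -> f1 f2 fe; [rewrite fe in f1 | rewrite fe in f2].
    by case/negP: is2; rewrite es2 mem_cat inE mem_cat iq !orbT.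
by rewrite !key //; [right | left].
Qed.

Lemma first_occurrence (U : eqType) (P : pred U) (s : seq U) : has P s ->
  exists (p : seq U) z (q : seq U), [/\ s = p ++ z :: q, P z & ~~ has P p].
Proof.
elim: s => //= z s IH; case: (boolP (P z)) => [Pz _|nPz /= /IH[p [y [q [-> Py nPp]]]]].
  by exists [::], z, s.
by exists (z :: p), y, q; rewrite /= negb_or nPz.
Qed.

(** What the first jumps demand of [S] itself: the particle or hole they need that no earlier jump
    can have provided. *)
Definition compatible a S : Prop := forall x a1 a2, a = a1 ++ x :: a2 -> x \notin a2 ->
  (x - 1 \notin a2 -> x \in S) /\ (x + 1 \notin a2 -> x + 1 \notin S).

Lemma compatible_cons i a S : compatible (i :: a) S -> compatible a S.
Proof. by move=> cS x a1 a2 ea; apply: (cS x (i :: a1) a2); rewrite ea. Qed.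

Lemma actw_idle a S x : x \notin a -> x - 1 \notin a -> (x \in actw a S) = (x \in S).
Proof.
elim: a => //= j a IH; rewrite !in_cons !negb_or => /andP[xj xa] /andP[x1j x1a].
by rewrite in_act (negbTE xj) -subr_eq (negbTE x1j) IH.
Qed.

Lemma actw_frozen p b S x : x \notin p -> x - 1 \notin p ->
  (x \in actw (p ++ b) S) = (x \in actw b S).
Proof. by move=> xp x1p; rewrite actw_cat actw_idle. Qed.

(** Read [a] from the left up to the first letter touching the site [i]. Interleaving prevents it
    from being [i], so it is [i - 1], which has just filled the site; if there is none, [S] provides
    the particle. The hole at [i + 1] is treated in the same way with the letter [i + 1]. *)
Lemma compatible_up a S : interleaved a -> compatible a S -> up a S.
Proof.
elim: a => //= i a IH ia cS; have iac := interleaved_cons ia.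
have ua := IH iac (compatible_cons cS); rewrite ua /=; apply/andP; split.
- case: (boolP (has (fun z => (z == i) || (z == i - 1)) a)) => [|/hasPn none].
    move=> /first_occurrence[p [z [q [ea zi /hasPn np]]]].
    have ip : i \notin p by apply/negP=> /np; rewrite eqxx.
    have i1p : i - 1 \notin p by apply/negP=> /np; rewrite eqxx orbT.
    case: (eqVneq z i) zi ea => [-> _|_ /= /eqP ->] ea.
      by have := ia i [::] p q; rewrite ea => /(_ erefl ip); rewrite (negbTE i1p) andbF.
    rewrite ea actw_frozen //= in_act eq_sym (negbTE (Zp_sub1_neq i)) subrK eqxx.
    by move: ua; rewrite ea up_cat /= => /andP[/and3P[]].
  have ia0 : i \notin a by apply/negP=> /none; rewrite eqxx.
  have i1a : i - 1 \notin a by apply/negP=> /none; rewrite eqxx orbT.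
  by rewrite actw_idle //; have [+ _] := cS i [::] a erefl ia0; apply.
- case: (boolP (has (fun z => (z == i) || (z == i + 1)) a)) => [|/hasPn none].
    move=> /first_occurrence[p [z [q [ea zi /hasPn np]]]].
    have ip : i \notin p by apply/negP=> /np; rewrite eqxx.
    have i1p : i + 1 \notin p by apply/negP=> /np; rewrite eqxx orbT.
    case: (eqVneq z i) zi ea => [-> _|_ /= /eqP ->] ea.
      by have := ia i [::] p q; rewrite ea => /(_ erefl ip); rewrite (negbTE i1p).
    rewrite ea actw_frozen ?addrK //= in_act eqxx.
    by move: ua; rewrite ea up_cat /= => /andP[/and3P[]].
  have ia0 : i \notin a by apply/negP=> /none; rewrite eqxx.
  have i1a : i + 1 \notin a by apply/negP=> /none; rewrite eqxx orbT.
  by rewrite actw_idle ?addrK //; have [_] := cS i [::] a erefl ia0; apply.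
Qed.

End Avoiding.

(** * States raised by a 321-avoiding element, and the two bounds *)

Section Marks.
Variable n : nat.
Hypothesis hn : (1 < n)%N.
Implicit Types (i j x y e f : 'Z_n) (a b s : seq 'Z_n) (S T J : {set 'Z_n}) (u v w : affSym n).

(* The letters of [a] whose last occurrence has no neighbour [+ e] to its right: the
   particles ([e = -1]), resp. the holes shifted by one ([e = 1]), that every state
   raised by [a] must contain. *)
Fixpoint marks e a : seq 'Z_n :=
  if a is i :: a' then
    if (i \notin a') && (i + e \notin a') then i :: marks e a' else marks e a'
  else [::].

Fixpoint unmarked e a : seq 'Z_n :=
  if a is i :: a' then
    if (i \notin a') && (i + e \notin a') then unmarked e a' else i :: unmarked e a'
  else [::].

Lemma marks_sub e a x : x \in marks e a -> x \in a.
Proof.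
elim: a => //= i a IH; rewrite in_cons; case: ifP => _; last by move=> /IH ->; rewrite orbT.
by rewrite in_cons => /orP[->|/IH ->]; rewrite ?orbT.
Qed.

Lemma marks_intro e a1 a2 x : x \notin a2 -> x + e \notin a2 -> x \in marks e (a1 ++ x :: a2).
Proof.
move=> x1 x2; elim: a1 => [|i a1 IH] /=; first by rewrite x1 x2 mem_head.
by case: ifP => // _; rewrite in_cons IH orbT.
Qed.

Lemma uniq_marks e a : uniq (marks e a).
Proof.
elim: a => //= i a IH; case: ifP => //= /andP[ia _]; rewrite IH andbT.
by apply: contraNN ia; exact: marks_sub.
Qed.

Lemma marks_neq_nil e a : a != [::] -> marks e a != [::].
Proof.
elim: a => //= i [|j a] IH _ //=; case: ifP => // _.
exact: IH.
Qed.

(** For [e = 1] this order is that of a cyclically decreasing word, for [e = -1] that of an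
    increasing one. *)
Lemma index_marks e a x : e != 0 -> x \in marks e a -> x - e \in marks e a ->
  (index x (marks e a) < index (x - e)%R (marks e a))%N.
Proof.
move=> e0; elim: a => //= i a IH; case: ifP => [/andP[ia iea]|_]; last exact: IH.
have xe : x - e != x by rewrite -subr_eq0 addrC addKr oppr_eq0.
rewrite !in_cons /= (eq_sym i x) (eq_sym i (x - e)).
case: (eqVneq x i) => [<-|xi] /=; first by rewrite (negbTE xe).
move=> xm; case: eqVneq => [xei|_] /=.
  by case/negP: iea; rewrite -xei subrK; exact: marks_sub xm.
exact: IH.
Qed.

Lemma unmarked_mem e a f : f \in unmarked e a ->
  exists a1 a2, a = a1 ++ f :: a2 /\ ((f \in a2) || (f + e \in a2)).
Proof.
elim: a => //= i a IH; case: ifPn => [_ /IH[a1 [a2 [-> fa]]]|].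
  by exists (i :: a1), a2.
rewrite negb_and !negbK => ia; rewrite in_cons => /orP[/eqP ->|/IH[a1 [a2 [-> fa]]]].
  by exists [::], a.
by exists (i :: a1), a2.
Qed.

Lemma size_unmarked e a : (size (unmarked e a) + size (marks e a) = size a)%N.
Proof. by elim: a => //= i a IH; case: ifP => _ /=; rewrite ?addnS ?addSn IH. Qed.

(** A marked [i] commutes with the unmarked letters to its right. An unmarked [i - e] would be
    followed by [i], or by another [i - e] and hence, by interleaving, by an [i] in between; but a
    marked [i] does not recur. *)
Lemma interleaved_extract e a : e = 1 \/ e = - 1 -> interleaved a ->
  cox_eq a (unmarked e a ++ marks e a).
Proof.
move=> he; elim: a => [|i a IH] ia /=; first exact: cox_refl.
have iac := interleaved_cons ia; have {}IH := IH iac.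
case: ifP => [/andP[ia0 iea]|_]; last exact: (cox_catl [:: i] IH).
apply: cox_trans (cox_catl [:: i] IH) _.
have u1 : i + e \notin unmarked e a.
  by apply/negP=> /unmarked_mem[a1 [a2 [ea _]]]; rewrite ea mem_cat mem_head orbT in iea.
have u2 : i - e \notin unmarked e a.
  apply/negP=> /unmarked_mem[a1 [a2 [ea]]]; rewrite subrK => /orP[fa2|ia2]; last first.
    by rewrite ea mem_cat in_cons ia2 !orbT in ia0.
  have [p [z [q [ea2 /eqP zf nz]]]] : exists p z q, [/\ a2 = p ++ z :: q, z == i - e &
      ~~ has (pred1 (i - e)) p].
    by apply: first_occurrence; rewrite has_pred1.
  rewrite has_pred1 in nz; subst z.
  have /andP[f1 f2] := iac (i - e) a1 p q (etrans ea (congr1 (fun s => a1 ++ _ :: s) ea2)) nz.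
  have ip : i \in p.
    by case: he f1 f2 => ->; rewrite ?opprK ?addrK ?subrK.
  by rewrite ea ea2 mem_cat in_cons mem_cat ip !orbT in ia0.
have [v1 v2] : i + 1 \notin unmarked e a /\ i - 1 \notin unmarked e a.
  by case: he u1 u2 => ->; rewrite ?opprK.
exact: cox_comm_seqr.
Qed.

(** Otherwise [x] and [x - 1] would both occur, with neither following the last occurrence of the
    other. So no site is forced to be both occupied and empty. *)
Lemma marks_disjoint a x : x \in marks (- 1) a -> x - 1 \notin marks 1 a.
Proof.
elim: a => //= i a IH; case: ifP => [/andP[ia i1a]|_].
  rewrite in_cons => /orP[/eqP ->|xm].
    apply/negP; case: ifP => _; rewrite ?in_cons ?(negbTE (Zp_sub1_neq i)) /= => /marks_sub;
      exact/negP.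
  case: ifP => [/andP[_ i1']|_]; last exact: IH.
  rewrite in_cons negb_or IH // andbT; apply: contraNneq i1' => <-.
  by rewrite subrK; exact: marks_sub xm.
move=> xm; case: ifP => [/andP[_ i1']|_]; last exact: IH.
rewrite in_cons negb_or IH // andbT; apply: contraNneq i1' => <-.
by rewrite subrK; exact: marks_sub xm.
Qed.

Definition mark_set e a : {set 'Z_n} := [set x in marks e a].

Definition hole_set a : {set 'Z_n} := [set x | x - 1 \in marks 1 a].

Lemma card_mark_set e a : #|mark_set e a| = size (marks e a).
Proof. by rewrite cardsE; exact/card_uniqP/uniq_marks. Qed.

Lemma card_hole_set a : #|hole_set a| = #|mark_set 1 a|.
Proof.
rewrite -(card_imset _ (addIr (- 1 : 'Z_n))); apply: eq_card => x; rewrite !inE.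
apply/imsetP/idP => [[y]|xm]; first by rewrite inE => ym ->.
by exists (x + 1); rewrite ?inE addrK.
Qed.

Lemma marks_disjoint_set a : mark_set (- 1) a \subset ~: hole_set a.
Proof.
by apply/fintype.subsetP=> x; rewrite !inE => /marks_disjoint.
Qed.

Lemma card_marks_le a : (#|mark_set (- 1)%R a| + #|mark_set 1%R a| <= n)%N.
Proof.
rewrite -card_hole_set -[X in (_ <= X)%N](card_Zmod hn) -(cardsC (hole_set a)) addnC.
by rewrite leq_add2l; apply: fintype.subset_leq_card; exact: marks_disjoint_set.
Qed.

Lemma compatible_marks a S : mark_set (- 1) a \subset S -> S \subset ~: hole_set a ->
  compatible a S.
Proof.
move=> /fintype.subsetP mS /fintype.subsetP Sh x a1 a2 ea xa2; split=> xe.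
  by apply: mS; rewrite inE ea marks_intro.
by apply/negP=> /Sh; rewrite !inE addrK ea marks_intro.
Qed.

Lemma intermediate_set (T : finType) (A B : {set T}) (m : nat) :
  A \subset B -> (#|A| <= m <= #|B|)%N ->
  exists C : {set T}, [/\ A \subset C, C \subset B & #|C| = m].
Proof.
move=> AB; move: {-1}(m - #|A|)%N (erefl (m - #|A|)%N) => k.
elim: k A AB => [|k IH] A AB mk /andP[Am mB].
  exists A; split=> //; apply/eqP; rewrite eqn_leq Am /= -subn_eq0.
  by rewrite mk.
have /subsetPn[x xB xA] : ~~ (B \subset A).
  apply/negP=> /fintype.subset_leq_card; move: mk mB; clear; lia.
have cx : #|x |: A| = #|A|.+1 by rewrite cardsU1 xA.
have [||| C [xC CB cC]] := IH (x |: A).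
- by rewrite finset.subUset finset.sub1set xB.
- by rewrite cx; move: mk; clear; lia.
- by rewrite cx mB andbT; move: mk; clear; lia.
exists C; split=> //; apply: fintype.subset_trans xC; exact: finset.subsetUr.
Qed.

(** For a nonempty word both kinds of marks exist and together number at most [n], so neither fills
    the cycle. *)
Lemma mark_set_proper e a : e = 1 \/ e = - 1 -> mark_set e a \proper [set: 'Z_n].
Proof.
move=> he; rewrite properEcard finset.subsetT cardsT card_Zmod //=.
case: (eqVneq a [::]) => [->|a0]; first by rewrite card_mark_set /= ltnW.
have := card_marks_le a; have := marks_neq_nil 1 a0; have := marks_neq_nil (- 1) a0.
rewrite -!size_eq0 -!card_mark_set -!lt0n => p1 p2 le_n.
case: he => ->; apply: leq_trans le_n; first by rewrite -addn1 addnC leq_add2r.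
by rewrite -addn1 leq_add2l.
Qed.

Lemma maxc_marks w a : interleaved a -> reduced_word w a -> (#|mark_set (- 1)%R a| <= maxc w)%N.
Proof.
move=> ia ra; have hN : (- 1 : 'Z_n) = 1 \/ (- 1 : 'Z_n) = - 1 by right.
have red : reduced_word w (unmarked (- 1) a ++ marks (- 1) a).
  apply: reduced_cox ra; first exact: (interleaved_extract hN ia).
  by rewrite size_cat size_unmarked.
apply: (leq_bigmax_cond (F := fun J : {set 'Z_n} => #|J|)).
rewrite mark_set_proper //=; apply/asboolP.
exists (wprod (unmarked (- 1) a)), (wprod (marks (- 1) a)); split.
- exists (marks (- 1) a) => //; split; first exact: uniq_marks.
    by move=> x; rewrite inE.
  move=> j; rewrite !inE => jm j1m; have := @index_marks (- 1) a j.
  by rewrite opprK oppr_eq0 oner_eq0; apply.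
- by rewrite -wprod_cat red.1.
- by rewrite card_mark_set -red.2 size_cat (reduced_catl red).2.
Qed.

Lemma maxr_marks w a : interleaved a -> reduced_word w a -> (#|mark_set 1%R a| <= maxr w)%N.
Proof.
move=> ia ra; have h1 : (1 : 'Z_n) = 1 \/ (1 : 'Z_n) = - 1 by left.
have red : reduced_word w (unmarked 1 a ++ marks 1 a).
  apply: reduced_cox ra; first exact: (interleaved_extract h1 ia).
  by rewrite size_cat size_unmarked.
apply: (leq_bigmax_cond (F := fun J : {set 'Z_n} => #|J|)).
rewrite mark_set_proper //=; apply/asboolP.
exists (wprod (unmarked 1 a)), (wprod (marks 1 a)); split.
- exists (marks 1 a) => //; split; first exact: uniq_marks.
    by move=> x; rewrite inE.
  move=> j; rewrite !inE => jm j1m; have := @index_marks 1 a (j + 1).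
  by rewrite addrK oner_eq0; apply.
- by rewrite -wprod_cat red.1.
- by rewrite card_mark_set -red.2 size_cat (reduced_catl red).2.
Qed.

(** The marked letters form right factors [u_J] and [d_J], so at most [m] particles and at most
    [n - m] holes are forced, at disjoint sites. Any [m] sites in between will do. *)
Lemma avoids321_raises w m : avoids321 w -> (maxc w <= m)%N -> (maxr w <= n - m)%N ->
  (m <= n)%N -> exists2 S : {set 'Z_n}, #|S| = m & raises w S.
Proof.
move=> aw cw rw mn; have ra := rwordP w; have ia := avoids321_interleaved aw ra.
have [||S [mS Sh cS]] := @intermediate_set _ (mark_set (- 1) (rword w)) (~: hole_set (rword w)) m.
- exact: marks_disjoint_set.
- rewrite (leq_trans (maxc_marks ia ra) cw) /=.
  have := cardsC (hole_set (rword w)); rewrite card_Zmod // card_hole_set => e.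
  have := leq_trans (maxr_marks ia ra) rw; move: e mn.
  by move: #|mark_set 1 _| #|~: hole_set _| => k l; clear; lia.
by exists S => //; apply: (compatible_up ia); exact: compatible_marks.
Qed.

Lemma avoids321_raises_some w : avoids321 w ->
  exists S : {set 'Z_n}, (0 < #|S| < n)%N /\ raises w S.
Proof.
move=> aw; have ra := rwordP w; have ia := avoids321_interleaved aw ra.
case: (eqVneq (rword w) [::]) => [e|a0].
  by exists [set 0]%SET; rewrite cards1 hn /raises e.
exists (mark_set (- 1) (rword w)); split; last first.
  by apply: (compatible_up ia); apply: compatible_marks => //; exact: marks_disjoint_set.
have := card_marks_le (rword w).
have := marks_neq_nil 1 a0; have := marks_neq_nil (- 1) a0.
rewrite -!size_eq0 -!card_mark_set -!lt0n => -> p2 le_n /=.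
by apply: leq_trans le_n; rewrite -addn1 leq_add2l.
Qed.

Lemma valid_card J S : valid J S -> (#|J| <= n - #|S|)%N.
Proof.
move=> /validP vJ; have -> : (n - #|S| = #|~: S|)%N.
  have := cardsC S; rewrite card_Zmod //.
  by move: #|S| #|~: S| => k l; clear; lia.
rewrite -(card_imset _ (addIr (1 : 'Z_n))); apply: fintype.subset_leq_card.
by apply/fintype.subsetP=> _ /imsetP[j /vJ[j1 _] ->]; rewrite inE.
Qed.

Lemma raises_maxr u S : raises u S -> (maxr u <= n - #|S|)%N.
Proof.
move=> ru; apply/bigmax_leqP => J /andP[pJ /asboolP[v [x [dx eu lu]]]].
rewrite (is_d_delt pJ dx) in eu; apply: valid_card; rewrite -(raises_delt _ pJ).
move: ru; rewrite eu raisesM; first by case/andP.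
by rewrite -eu lu len_delt.
Qed.

(** In an increasing word each letter moves a particle of its own, one step. This bounds [maxc] by
    the particles, as the landing sites of decreasing moves bound [maxr] by the holes. *)
Lemma incr_up_sub J a S : incr_word J a -> up a S -> J \subset S.
Proof.
elim/last_ind: a J S => [|a j IH] J S [ua aJ idx].
  by move=> _; apply/fintype.subsetP=> x; rewrite -aJ.
rewrite -cats1 up_cat /= => /andP[/andP[jS j1S] upa].
move: ua; rewrite rcons_uniq => /andP[ja ua].
have jJ : j \in J by rewrite -aJ mem_rcons mem_head.
have j1J : j + 1 \notin J.
  apply/negP=> j1J; have := idx j jJ j1J; rewrite (index_rcons_last ja) ltnNge.
  by rewrite -ltnS -(size_rcons a j) index_mem aJ j1J.
have memJ x : (x \in J :\ j) = (x \in a).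
  rewrite in_setD1 -aJ mem_rcons inE; case: eqVneq => [->|//].
  by rewrite (negbTE ja).
have /fintype.subsetP sub : J :\ j \subset act j S.
  apply: IH upa; split=> // x.
  rewrite !memJ => xa x1a.
  by have := idx x; rewrite -!aJ !mem_rcons !inE xa x1a !orbT !index_rcons_neq //; apply.
apply/fintype.subsetP=> x xJ; case: (eqVneq x j) => [-> //|xj].
have := sub x; rewrite in_setD1 xj xJ in_act (negbTE xj) => /(_ isT).
by case: eqVneq => // xj1; rewrite -xj1 xJ in j1J.
Qed.

Lemma raises_maxc u S : raises u S -> (maxc u <= #|S|)%N.
Proof.
move=> ru; apply/bigmax_leqP => J /andP[pJ /asboolP[v [x [[a ia ex] eu lu]]]].
have sa : size a = #|J| by case: ia => /card_uniqP <- aJ _; apply: eq_card.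
have lx : len x = #|J|.
  apply/eqP; rewrite eqn_leq -{1}sa ex len_le_size /= -(leq_add2l (len v)) -lu eu -ex.
  exact: len_mul.
move: ru; rewrite eu raisesM; last by rewrite -eu lu lx.
move=> /andP[+ _]; rewrite (@raisesE _ x a); last by split=> //; rewrite sa lx.
by move/(incr_up_sub ia); exact: fintype.subset_leq_card.
Qed.

(** The first [i] empties its site and the letter [i + 1] cannot refill it, so the second [i] has
    nothing to move. For [n = 2] the particle would come back round the cycle. *)
Lemma raises_avoids321 u S : (2 < n)%N -> raises u S -> avoids321 u.
Proof.
move=> n2 ru a b i red; move: ru; rewrite (raisesE _ red) !up_cat => /andP[/andP[_ +] _].
set T := actw b S => /= /and3P[/and3P[/andP[_ /negbTE i1T] _ _] + _].
have e1 : (i == i + 1) = false by rewrite eq_sym (negbTE (Zp_add1_neq i)).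
have e2 : (i == i + 1 + 1) = false.
  apply/negP=> /eqP e; suff /Zp_add1_eq_sub1 : i + 1 == i - 1 by rewrite leqNgt n2.
  by rewrite {2}e addrK.
by rewrite !in_act e1 e2 eqxx i1T.
Qed.

End Marks.

(** * Expansion of affine Stanley functions *)

Section Expansion.
Variable n : nat.
Hypothesis hn : (1 < n)%N.
Implicit Types (S T J : {set 'Z_n}) (u v w : affSym n) (al : seq nat).

Lemma raises_vac_grassmannian (m : nat) u : (0 < m)%N -> (m < n)%N -> raises u (vac n m) ->
  grassmannian0 u.
Proof.
move=> m0 mn ru a j red; move: ru; rewrite (raisesE _ red) -cats1 up_cat /=.
by case/andP=> /andP[jv j1v] _; exact: vac_start jv j1v.
Qed.

Lemma expansion_support w S (c : affSym n -> int) :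
  (0 < #|S| < n)%N -> raises w S ->
  finite_set [set u | grassmannian0 u /\ c u != 0]%classic ->
  (forall al, affStanley w al = \sum_(u \in @grassmannian0 n) c u * affStanley u al) ->
  forall u, grassmannian0 u -> c u != 0 -> raises u (vac n #|S|) /\ len u = len w.
Proof.
move=> /andP[m0 mn] rw cfin hc; set m := #|S| in m0 mn *; set V := vac n m.
have S0 : S != finset.set0 by rewrite -card_gt0.
have V0 : V != finset.set0 by rewrite -card_gt0 card_vac.
have [A Ar Av] := all_reached hn m0 (erefl : #|S| = m).
(* Since [A] commutes with the Pieri operators, it turns evaluation at [S] into evaluation at the
   vacuum with [k] in place of the target; [k T] becomes the coefficient of the element taking the
   vacuum to [T]. *)
pose k := A (delta (actg w S)).
have Apieris al phi : A (pieris al phi) = pieris al (A phi).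
  by elim/last_ind: al => [|al r IH] //; rewrite !pieris_rcons Ar IH.
pose P T u := [/\ raises u V, actg u V = T & len u = len w].
pose U T := xget 1%g (P T).
have UP T : (exists u, P T u) -> P T (U T) by move=> [u Pu]; apply: (xgetPex 1%g); exists u.
pose R : seq {set 'Z_n} := [seq T <- index_enum {set 'Z_n} | `[< exists u, P T u >]].
have RP T : T \in R -> P T (U T) by rewrite mem_filter => /andP[/asboolP/UP].
have Fw al : affStanley w al = \sum_(T <- R) k T * affStanley (U T) al.
  (* Outside the degree [len w] both sides vanish by homogeneity; the description by Pieri operators
     applies only in that degree. *)
  case: (eqVneq (sumn al) (len w)) => lw; last first.
    rewrite [LHS](_ : _ = 0); last first.
      by apply: contrapT => /eqP/affStanley_homogeneous/eqP; rewrite (negbTE lw).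
    rewrite big_seq big1 // => T /RP[_ _ lT]; rewrite [X in _ * X](_ : _ = 0) ?mulr0 //.
    by apply: contrapT => /eqP/affStanley_homogeneous/eqP; rewrite lT (negbTE lw).
  rewrite (affStanley_pieris S0 rw erefl (esym lw)) Av Apieris pieris_delta -/k.
  rewrite /R big_filter [LHS](bigID (fun T => `[< exists u, P T u >])) /=.
  rewrite [X in _ + X]big1 ?addr0 => [|T /asboolPn nP]; last first.
    apply/eqP; rewrite mulf_eq0; apply/orP; right; apply: contrapT => /negP ne.
    apply: nP; have [u [ru au lu]] := pieris_delta_neq0 V0 ne.
    by exists u; split; rewrite // lu lw.
  apply: eq_bigr => T /asboolP/UP[rU aU lU].
  by rewrite (affStanley_pieris V0 rU aU) // lU lw.
pose Lw := map U R.
have uLw : uniq Lw.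
  rewrite map_inj_in_uniq ?filter_uniq ?index_enum_uniq // => T T' /RP[_ aT _] /RP[_ aT' _] e.
  by rewrite -aT -aT' e.
have LwP u : u \in Lw -> raises u V /\ len u = len w.
  by move=> /mapP[T /RP[rT _ lT] ->].
(* A finite list containing the supports of both expansions, so that their difference is a finite
   linear relation. *)
pose L := undup (Lw ++ fset_set [set u | grassmannian0 u /\ c u != 0]%classic).
have memL u : u \in L = (u \in Lw) || `[< grassmannian0 u /\ c u != 0 >].
  rewrite mem_undup mem_cat; congr (_ || _); rewrite in_fset_set //.
have gL u : u \in L -> grassmannian0 u.
  rewrite memL => /orP[/LwP[+ _]|/asboolP[]//].
  exact: raises_vac_grassmannian.
pose d u := if u \in Lw then k (actg u V) else 0.
have dz : {in L, forall u, c u - d u = 0}.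
  apply: (@affStanley_independent n hn (\max_(u <- L) len u).+1 0 L).
  - exact: undup_uniq.
  - exact: gL.
  - by move=> u uL; rewrite ltnS (leq_bigmax_seq _ uL).
  - move=> al; under eq_bigr do rewrite mulrBl.
    rewrite big_split /= sumrN; apply/eqP; rewrite subr_eq0; apply/eqP.
    transitivity (affStanley w al).
      rewrite hc (fsbigE L) ?undup_uniq //.
      + rewrite big_seq [RHS]big_seq_cond; apply: eq_bigl => u.
        by case: (boolP (u \in L)) => //= /gL gu; rewrite mem_set.
      + move=> u gu; rewrite memL negb_or => /andP[_ /asboolPn nc].
        have -> : c u = 0 by apply: contrapT => /eqP cu; apply: nc.
        by rewrite mul0r.
    rewrite Fw /d; under [RHS]eq_bigr do rewrite (fun_if (fun z => z * _)) mul0r.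
    rewrite -big_mkcond -big_filter.
    have -> : \sum_(u <- [seq u <- L | u \in Lw]) k (actg u V) * affStanley u al =
        \sum_(u <- Lw) k (actg u V) * affStanley u al.
      apply: perm_big; apply: uniq_perm; rewrite ?filter_uniq ?undup_uniq // => u.
      by rewrite mem_filter memL; case: (u \in Lw).
    rewrite /Lw big_map big_seq [RHS]big_seq; apply: eq_bigr => T /RP[_ -> _] //.
move=> u gu cu; have uL : u \in L by rewrite memL; apply/orP; right; apply/asboolP.
apply: LwP; have := dz u uL; rewrite /d; case: ifP => // _ /eqP.
by rewrite subr0 (negbTE cu).
Qed.

(** Here the cycle has two sites and a reduced word alternates, so its first three letters would
    already form the forbidden factor. *)
Lemma avoids321_len_le2 w : (n <= 2)%N -> avoids321 w -> (len w <= 2)%N.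
Proof.
move=> n2 aw; have nb (x y : 'Z_n) : x != y -> x = y + 1.
  move=> xy; apply: val_inj; move: x y xy; case: (n) n2 => [|[|[|?]]] // _;
    by move=> [[|[|?]] ?] [[|[|?]] ?].
have ra := rwordP w; rewrite -ra.2; case: (rword w) ra => [|i [|j [|l a]]] //= ra.
have ij : j != i by apply/eqP=> e; apply: (@not_reduced_square n w [::] (l :: a) i); rewrite -{2}e.
have jl : l != j by apply/eqP=> e; apply: (@not_reduced_square n w [:: i] a j); rewrite -{2}e.
have li : l = i by rewrite (nb _ _ jl) [RHS](nb i j) // eq_sym.
by case: (aw [::] a i); move: ra; rewrite li (nb _ _ ij).
Qed.

End Expansion.

Local Open Scope classical_set_scope.

Theorem theorem8 (n : nat) (hn : (1 < n)%N) (w : affSym n)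
    (hw : avoids321 w) (c : affSym n -> int)
    (c_fin : finite_set [set u | grassmannian0 u /\ c u != 0])
    (hc : forall alpha : seq nat,
       affStanley w alpha =
       \sum_(u \in @grassmannian0 n) c u * affStanley u alpha) :
  (forall u, grassmannian0 u -> ~ avoids321 u -> c u = 0) /\
  (forall m : nat, (0 < m < n)%N ->
     (maxc w <= m)%N -> (maxr w <= n - m)%N ->
     forall u, grassmannian0 u -> ~ A0 m u -> c u = 0).
Proof.
have avoid (S : {set 'Z_n}) (u : affSym n) : raises u S -> len u = len w -> avoids321 u.
  move=> ru lu; case: (ltnP 2 n) => n2; first exact: (raises_avoids321 n2 ru).
  (* For [n = 2] raising a state does not exclude the pattern; the common length of [u] and [w]
     does, being at most 2. *)
  move=> a b i [_ sz]; have := avoids321_len_le2 n2 hw; rewrite -lu -sz !size_cat /=.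
  by clear; lia.
split=> [u gu nau|m mn cw rw u gu nau].
  apply: contrapT => /eqP cu; have [S [Sn rw]] := avoids321_raises_some hn hw.
  have [ru lu] := expansion_support hn Sn rw c_fin hc gu cu.
  by apply: nau; exact: avoid ru lu.
apply: contrapT => /eqP cu; have /andP[m0 ltmn] := mn.
have [S cS rS] := avoids321_raises hn hw cw rw (ltnW ltmn).
rewrite -cS in mn; have := expansion_support hn mn rS c_fin hc gu cu.
rewrite cS => -[ru lu]; apply: nau; split=> //; first exact: avoid ru lu.
  by have := raises_maxc ru; rewrite card_vac.
by have := raises_maxr hn ru; rewrite card_vac.
Qed.
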